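(* Let $(A,d,\nu)$ be a dg-algebra and choose a deformation retract of $(A,d)$ onto its homology $(H_*(A),0)$: chain maps $p:A\to H_*(A)$, $i:H_*(A)\to A$ and a homotopy $h:A\to A$ of degree $+1$ with \[ pi=\mathrm{id},\quad \mathrm{id}-ip=dh+hd,\quad h^2=0,\quad ph=0,\quad hi=0, \] where $i$ sends each homology class to a cycle representing it. Let $\lambda_2:=\nu$ and, for $n\ge3$, \[ \lambda_n:=\sum_{\substack{k+l=n\\k,l\ge1}}(-1)^{k(l+1)}\nu(h\lambda_k\otimes h\lambda_l),\qquad\text{with the convention } h\lambda_1:=-\mathrm{id}. \] Then $m_1:=0$ and $m_n:=p\circ\lambda_n\circ i^{\otimes n}$ for $n\ge2$ defines an $A_\infty$-structure on $H_*(A)$. The maps $i_1:=i$ and $i_n:=-h\circ\lambda_n\circ i^{\otimes n}$ for $n\ge2$ define a minimal model \[ i:(H_*(A),m)\to(A,d). \] Moreover the minimal model is unique up to isomorphism: for any other minimal model $i':(H_*(A),m')\to(A,d)$ there is an isomorphism of $A_\infty$-algebras $(H_*(A),m')\to(H_*(A),m)$.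
   Context: Graded vector spaces are $\mathbb Z$-graded over a field $k$; tensor products of graded maps use the Koszul sign convention $(f\otimes g)(v\otimes w)=(-1)^{|g||v|}f(v)\otimes g(w)$. A dg-algebra $(A,d,\nu)$ is a graded associative unital algebra with product $\nu$ of degree $0$ and $d$ of degree $-1$ with $d^2=0$, $d\nu=\nu(d\otimes\mathrm{id}+\mathrm{id}\otimes d)$; it is regarded as an $A_\infty$-algebra with $m_1=d$, $m_2=\nu$, $m_n=0$ for $n\ge3$. An $A_\infty$-algebra $(A,m)$ is a graded vector space with maps $m_n:A^{\otimes n}\to A$ of degree $n-2$, $n\ge1$, such that for all $n\ge1$: $\sum_{r+s+t=n,\ s\ge1}(-1)^{rs+t}m_{r+t+1}(\mathrm{id}^{\otimes r}\otimes m_s\otimes\mathrm{id}^{\otimes t})=0$. A morphism $f:(A,m)\to(A',m')$ is a family $f_n:A^{\otimes n}\to A'$ of degree $n-1$ with $\sum_{r+s+t=n}(-1)^{rs+t}f_{r+t+1}(\mathrm{id}^{\otimes r}\otimes m_s\otimes\mathrm{id}^{\otimes t})=\sum_{i_1+\dots+i_r=n}(-1)^{l(i_1,\dots,i_r)}m'_r(f_{i_1}\otimes\dots\otimes f_{i_r})$ for all $n\ge1$, where $l(i_1,\dots,i_r)=\sum_{1\le j<k\le r}(i_k-1)i_j$. Composition is $(f'\circ f)_n=\sum_{i_1+\dots+i_r=n}(-1)^{l(i_1,\dots,i_r)}f'_r(f_{i_1}\otimes\dots\otimes f_{i_r})$; the identity has first component $\mathrm{id}$ and other components $0$. A morphism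 $f$ is a quasi-isomorphism if $f_1$ induces an isomorphism on homology. A minimal model of an $A_\infty$-algebra $(A,m)$ is an $A_\infty$-structure $m'$ on $H_*(A)=H_*(A,m_1)$ with $m'_1=0$ and $m'_2$ the product induced by $m_2$, together with a quasi-isomorphism of $A_\infty$-algebras $i:(H_*(A),m')\to(A,m)$ such that $i_1$ induces the identity map on homology. *)

(* Defs.v *)
From HB Require Import structures.
From mathcomp Require Import all_boot all_order all_algebra generic_quotient.
From mathcomp Require Import boolp zify.

Set Implicit Arguments.
Unset Strict Implicit.
Unset Printing Implicit Defensive.

Import GRing.Theory.
Local Open Scope ring_scope.
Local Open Scope quotient_scope.

(* Graded vector spaces are families (V_n)_(n : int). To avoid transporting
   vectors along equalities of degrees, a map of degree e is given by all its
   components V_i -> W_j, those with j != i + e being required to vanish. *)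
Definition gvect (k : fieldType) := int -> lmodType k.

Record glin (k : fieldType) (V W : gvect k) (e : int) := GLin {
  glin_fun :> forall i j : int, {linear V i -> W j};
  glin_deg : forall (i j : int) (x : V i), j != i + e -> glin_fun i j x = 0 }.

Definition homog (k : fieldType) (V : gvect k) := {i : int & V i}.

(* The list [:: v_1; ..; v_n] of homogeneous vectors stands for the tensor
   v_1 (x) .. (x) v_n, so degs is its total degree. *)
Definition degs (k : fieldType) (V : gvect k) (v : seq (homog V)) : int :=
  \sum_(x <- v) tag x.

(* A family of maps (f_n : V^{(x) n} -> W)_(n >= 1), all collected in a single
   function: f_n is the restriction of f to the lists of length n, and f v q is
   the component of degree q of f_n (v). The value on the empty list is
   irrelevant. *)
Definition gfam (k : fieldType) (V W : gvect k) :=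
  seq (homog V) -> forall q : int, W q.

Definition multilinear (k : fieldType) (V W : gvect k) (f : gfam V W) : Prop :=
  forall (v1 v2 : seq (homog V)) (i : int) (a : k) (x y : V i) (q : int),
    f (v1 ++ Tagged V (a *: x + y) :: v2) q =
    a *: f (v1 ++ Tagged V x :: v2) q + f (v1 ++ Tagged V y :: v2) q.

(* f_n has degree n + e for all n >= 1 *)
Definition gfam_degree (k : fieldType) (V W : gvect k) (e : int)
    (f : gfam V W) : Prop :=
  forall (v : seq (homog V)) (q : int), v != [::] ->
    q != degs v + ((size v)%:Z + e) -> f v q = 0.

Definition is_gfam (k : fieldType) (V W : gvect k) (e : int)
    (f : gfam V W) : Prop := multilinear f /\ gfam_degree e f.

(* The homogeneous vector f_n (v), when f_n has degree n + e *)
Definition happ (k : fieldType) (V W : gvect k) (e : int) (f : gfam V W)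
    (v : seq (homog V)) : homog W :=
  Tagged W (f v (degs v + ((size v)%:Z + e))).

Definition sgn (k : fieldType) (z : int) : k := (-1) ^ z.

(* sum_(r+s+t = n, s >= 1) (-1)^(rs+t) f_(r+t+1) (id^r (x) m_s (x) id^t),
   for m_s of degree s - 2; the factor sgn ((s - 2) * _) is the Koszul sign. *)
Definition insertion (k : fieldType) (V W : gvect k) (f : gfam V W)
    (m : gfam V V) : gfam V W := fun v q =>
  \sum_(0 <= r < size v) \sum_(1 <= s < (size v - r).+1)
    let t := (size v - r - s)%N in
    (sgn k (r * s + t)%N * sgn k ((s%:Z - 2) * degs (take r v))) *:
    f (take r v ++ happ (-2) m (take s (drop r v)) :: drop (r + s) v) q.

(* l(i_1, .., i_r) = sum_(1 <= j < k <= r) (i_k - 1) i_j *)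
Definition lsign (i : seq nat) : int :=
  \sum_(l < size i) \sum_(j < l) ((nth 0 i l)%:Z - 1) * (nth 0 i j)%:Z.

(* The exponent of the Koszul sign of (f_(i_1) (x) .. (x) f_(i_r)) evaluated on
   the concatenation of the blocks ws, where i_j is the length of the j-th block
   and f_n has degree n - 1. *)
Definition koszul (k : fieldType) (V : gvect k) (ws : seq (seq (homog V))) : int :=
  \sum_(l < size ws) \sum_(j < l)
    ((size (nth [::] ws l))%:Z - 1) * degs (nth [::] ws j).

(* sum_(i_1+..+i_r = n) (-1)^l(i_1,..,i_r) g_r (f_(i_1) (x) .. (x) f_(i_r)),
   for f_n of degree n - 1 *)
Definition gcomp (k : fieldType) (U V W : gvect k) (g : gfam V W)
    (f : gfam U V) : gfam U W := fun v q =>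
  \sum_(1 <= r < (size v).+1)
   \sum_(i : r.-tuple 'I_(size v).+1 | all (fun a : 'I__ => 0 < a)%N i
                                  && (\sum_(a <- i) a == size v)%N)
    let sh := [seq nat_of_ord a | a <- i] in
    let ws := reshape sh v in
    (sgn k (lsign sh) * sgn k (koszul ws)) *: g [seq happ (-1) f w | w <- ws] q.

Definition gfam_id (k : fieldType) (V : gvect k) : gfam V V := fun v q =>
  if v is [:: x] then untag (0 : V q) id (x : {i : int & V i}) else 0.

Definition gfam_eq (k : fieldType) (V W : gvect k) (f g : gfam V W) : Prop :=
  forall (v : seq (homog V)) (q : int), v != [::] -> f v q = g v q.

Definition is_Ainfty (k : fieldType) (V : gvect k) (m : gfam V V) : Prop :=
  is_gfam (-2) m /\ gfam_eq (insertion m m) (fun _ _ => 0).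

Record Ainfty (k : fieldType) (V : gvect k) := MkAinfty {
  Ainfty_op :> gfam V V;
  AinftyP : is_Ainfty Ainfty_op }.

Definition is_morphism (k : fieldType) (V W : gvect k) (m : Ainfty V)
    (m' : Ainfty W) (f : gfam V W) : Prop :=
  is_gfam (-1) f /\ gfam_eq (insertion f m) (gcomp m' f).

Definition is_isomorphism (k : fieldType) (V W : gvect k) (m : Ainfty V)
    (m' : Ainfty W) (f : gfam V W) : Prop :=
  is_morphism m m' f /\
  exists g : gfam W V,
    [/\ is_morphism m' m g, gfam_eq (gcomp g f) (@gfam_id k V)
      & gfam_eq (gcomp f g) (@gfam_id k W)].

Section Homology.
Variables (k : fieldType) (V : gvect k) (d : glin V V (-1)) (n : int).

Definition is_cycle : pred (V n) := fun x => d n (n - 1) x == 0.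

Lemma is_cycle_closed : subsemimod_closed is_cycle.
Proof.
split=> [|a x]; last first.
  by rewrite !unfold_in /is_cycle linearZ /= => /eqP ->; rewrite scaler0.
split=> [|x y]; first by rewrite unfold_in /is_cycle linear0.
by rewrite !unfold_in /is_cycle linearD => /eqP-> /eqP->; rewrite addr0.
Qed.

HB.instance Definition _ := GRing.isSubmodClosed.Build k (V n) is_cycle
  is_cycle_closed.

Record zcycle := ZCycle { zcycle_val : V n; _ : is_cycle zcycle_val }.

HB.instance Definition _ := [isSub for zcycle_val].
HB.instance Definition _ := [Choice of zcycle by <:].
HB.instance Definition _ := [SubChoice_isSubLmodule of zcycle by <:].

Definition boundary : pred zcycle :=
  fun z => `[< exists y : V (n + 1), d (n + 1) n y = val z >].

Lemma boundary_closed : subsemimod_closed boundary.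
Proof.
split=> [|a x]; last first.
  rewrite !unfold_in => /asboolP[y yx]; apply/asboolP.
  by exists (a *: y); rewrite !linearZ yx.
split=> [|x x']; first by apply/asboolP; exists 0; rewrite !linear0.
rewrite !unfold_in => /asboolP[y yx] /asboolP[y' yx']; apply/asboolP.
by exists (y + y'); rewrite !linearD yx yx'.
Qed.

HB.instance Definition _ := GRing.isSubmodClosed.Build k zcycle boundary
  boundary_closed.

Definition homology_at :=
  Quotient.quot (GRing.ZmodClosed.clone zcycle boundary _).
HB.instance Definition _ := GRing.Zmodule.on homology_at.
HB.instance Definition _ := EqQuotient.on homology_at.

Definition hscale (a : k) : homology_at -> homology_at :=
  fun c => \pi_homology_at (a *: repr c).

Let pi_scale (a : k) (z : zcycle) :
  hscale a (\pi_homology_at z) = \pi_homology_at (a *: z).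
Proof.
apply/eqP; rewrite /hscale -Quotient.idealrBE -scalerBr.
by rewrite rpredZ // Quotient.idealrBE reprK.
Qed.

Let pi_add (y z : zcycle) :
  \pi_homology_at (y + z) = \pi_homology_at y + \pi_homology_at z.
Proof. by rewrite /homology_at raddfD. Qed.

Fact homology_scalerA a b c : hscale a (hscale b c) = hscale (a * b) c.
Proof. by elim/quotW: c => z; rewrite (pi_scale b) !pi_scale scalerA. Qed.
Fact homology_scale1r : left_id 1 hscale.
Proof. by elim/quotW=> z; rewrite pi_scale scale1r. Qed.
Fact homology_scalerDr : right_distributive hscale +%R.
Proof.
move=> a; elim/quotW=> y; elim/quotW=> z.
by rewrite -pi_add !pi_scale -pi_add scalerDr.
Qed.
Fact homology_scalerDl c : {morph hscale^~ c : a b / a + b}.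
Proof.
by move=> a b /=; elim/quotW: c => z; rewrite !pi_scale -pi_add scalerDl.
Qed.

HB.instance Definition _ := GRing.Zmodule_isLmodule.Build k homology_at
  homology_scalerA homology_scale1r homology_scalerDr homology_scalerDl.

(* the class of a cycle (and 0 on vectors which are not cycles) *)
Definition hclass (x : V n) : homology_at :=
  \pi_homology_at (insubd (0 : zcycle) x).

Definition hrepr (c : homology_at) : V n := val (repr c).

End Homology.

Definition homology (k : fieldType) (V : gvect k) (d : glin V V (-1)) : gvect k :=
  fun n => homology_at d n.

Section FirstComponent.
Variables (k : fieldType) (V : gvect k) (m : Ainfty V).

Let m1fun (i j : int) (x : V i) : V j := Ainfty_op m [:: Tagged V x] j.

Fact m1_linear i j : linear (@m1fun i j).
Proof.
move=> a x y; case: (AinftyP m) => -[ml _] _.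
exact: (ml [::] [::] i a x y j).
Qed.

HB.instance Definition _ i j :=
  GRing.isLinear.Build k (V i) (V j) *:%R (@m1fun i j) (@m1_linear i j).

Fact m1_deg (i j : int) (x : V i) : j != i - 1 -> m1fun j x = 0.
Proof.
case: (AinftyP m) => -[_ mdeg] _ ne_j; apply: mdeg => //=.
by rewrite /degs big_seq1.
Qed.

Definition m1 : glin V V (-1) :=
  @GLin k V V (-1) (fun i j => @m1fun i j : {linear V i -> V j}) m1_deg.

End FirstComponent.

Definition Ainfty_homology (k : fieldType) (V : gvect k) (m : Ainfty V) :
  gvect k := homology (m1 m).

(* the map [z] |-> [f_1 z] induced by f_1 on homology in degree n *)
Definition homology_map (k : fieldType) (V W : gvect k) (m : Ainfty V)
    (m' : Ainfty W) (f : gfam V W) (n : int) (c : Ainfty_homology m n) :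
    Ainfty_homology m' n :=
  hclass (m1 m') (f [:: Tagged V (hrepr c)] n).

Arguments homology_map {k V W} m m' f {n} c.

Definition is_quasi_isomorphism (k : fieldType) (V W : gvect k) (m : Ainfty V)
    (m' : Ainfty W) (f : gfam V W) : Prop :=
  is_morphism m m' f /\
  forall n : int,
    bijective (fun c : Ainfty_homology m n => homology_map m m' f c).

(* In the last clause, x |-> hclass (m1 m') x is the canonical identification of
   H_*(A) with the homology of (H_*(A), m'_1 = 0). *)
Definition is_minimal_model (k : fieldType) (A : gvect k) (m : Ainfty A)
    (m' : Ainfty (Ainfty_homology m)) (f : gfam (Ainfty_homology m) A) : Prop :=
  let H := Ainfty_homology m in
  [/\ forall (x : homog H) (q : int), Ainfty_op m' [:: x] q = 0,
      forall (i j : int) (a : A i) (b : A j),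
        is_cycle (m1 m) a -> is_cycle (m1 m) b ->
        Ainfty_op m' [:: Tagged H (hclass (m1 m) a); Tagged H (hclass (m1 m) b)]
          (i + j) =
        hclass (m1 m) (Ainfty_op m [:: Tagged A a; Tagged A b] (i + j)),
      is_quasi_isomorphism m' m f
    & forall (n : int) (x : H n), homology_map m' m f (hclass (m1 m') x) = x].

Arguments is_minimal_model {k A} m m' f.

Record dgAlg (k : fieldType) (A : gvect k) := MkDgAlg {
  dg_d : glin A A (-1);
  dg_mul : forall i j q : int, A i -> A j -> A q;
  dg_one : A 0;
  dg_mul_deg : forall (i j q : int) (x : A i) (y : A j),
    q != i + j -> dg_mul q x y = 0;
  dg_mul_linl : forall (i j q : int) (a : k) (x x' : A i) (y : A j),
    dg_mul q (a *: x + x') y = a *: dg_mul q x y + dg_mul q x' y;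
  dg_mul_linr : forall (i j q : int) (a : k) (x : A i) (y y' : A j),
    dg_mul q x (a *: y + y') = a *: dg_mul q x y + dg_mul q x y';
  dg_mulA : forall (i j l : int) (x : A i) (y : A j) (z : A l),
    dg_mul (i + j + l) (dg_mul (i + j) x y) z =
    dg_mul (i + j + l) x (dg_mul (j + l) y z);
  dg_mul1l : forall (i : int) (x : A i), dg_mul i dg_one x = x;
  dg_mul1r : forall (i : int) (x : A i), dg_mul i x dg_one = x;
  dg_dd : forall (i : int) (x : A i),
    dg_d (i - 1) (i - 1 - 1) (dg_d i (i - 1) x) = 0;
  (* the sign is the Koszul sign of id (x) d, as |d| = -1 *)
  dg_leibniz : forall (i j : int) (x : A i) (y : A j),
    dg_d (i + j) (i + j - 1) (dg_mul (i + j) x y) =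
    dg_mul (i + j - 1) (dg_d i (i - 1) x) y +
    sgn k (- i) *: dg_mul (i + j - 1) x (dg_d j (j - 1) y) }.

Definition dg_op (k : fieldType) (A : gvect k) (D : dgAlg A) : gfam A A :=
  fun v q =>
  match v with
  | [:: x] => dg_d D (tag x) q (tagged x)
  | [:: x; y] => dg_mul D q (tagged x) (tagged y)
  | _ => 0
  end.

Section DgAinfty.
Variables (k : fieldType) (A : gvect k) (D : dgAlg A).

Local Notation op := (dg_op D).

Fact dg_op_multilinear : multilinear op.
Proof.
move=> [|u [|u' v1]] [|w [|w' v2]] i a x y q /=; rewrite ?scaler0 ?addr0 //.
- by rewrite linearP.
- exact: dg_mul_linl.
- exact: dg_mul_linr.
- by case: v1 => [|? ?] /=; rewrite scaler0 addr0.
- by case: v1 => [|? ?] /=; rewrite scaler0 addr0.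
- by case: v1 => [|? ?] /=; rewrite scaler0 addr0.
Qed.

Fact dg_op_degree : gfam_degree (-2) op.
Proof.
move=> [|[i x] [|[j y] [|z v]]] q //= _; rewrite /degs ?big_cons big_nil /=.
  by move=> qN; apply: glin_deg; rewrite addr0 in qN.
by rewrite addr0 addr0 => qN; apply: dg_mul_deg.
Qed.

Let op_big v q : (2 < size v)%N -> op v q = 0.
Proof. by case: v => [|? [|? []]]. Qed.

Let op_zero v1 v2 i q : op (v1 ++ Tagged A (0 : A i) :: v2) q = 0.
Proof.
have := dg_op_multilinear v1 v2 1 (0 : A i) 0 q.
by rewrite !scale1r addr0 => /esym/eqP; rewrite -subr_eq0 addrK => /eqP.
Qed.

Fact dg_op_relation : gfam_eq (insertion op op) (fun _ _ => 0).
Proof.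
move=> v q; case: (ltnP 3 (size v)) => [v_gt3 _|].
  rewrite /insertion big_nat big1 // => r /= r_lt; rewrite big_nat big1 // => s.
  case/andP=> s_gt0 s_le; case: (ltnP 2 s) => s2.
    rewrite /happ [op (take _ _) _]op_big ?op_zero ?scaler0 //.
    by rewrite size_takel ?size_drop // -ltnS.
  rewrite op_big ?scaler0 // size_cat /= size_take r_lt size_drop.
  by move: r_lt s_le; clear -v_gt3 s2 s_gt0; lia.
have e1 : 1%:Z - 2 = -1 by [].
have e2 : 2%:Z - 2 = 0 by [].
have s0 : sgn k 0 = 1 by [].
have s1 : sgn k 1%N = -1 by [].
have s2 : sgn k 2%N = 1 by rewrite /sgn -exprnP expr2 mulN1r opprK.
have dn : degs ([::] : seq (homog A)) = 0 by rewrite /degs big_nil.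
have dc (u : homog A) v' : degs (u :: v') = tag u + degs v'.
  by rewrite /degs big_cons.
case: v => [|[i x] [|[j y] [|[l z] []]]] //= _ _.
- rewrite /insertion unlock /= /happ !dc !dn /= e1 !addr0.
  have [->|qN] := eqVneq q (i - 1 - 1); first by rewrite dg_dd scaler0.
  by rewrite glin_deg ?scaler0.
- rewrite /insertion unlock /= /happ !dc !dn /= e1 e2 !addr0 mulr0 mul0r.
  rewrite (_ : (0 * 1 + (2 - 0 - 1))%N = 1%N) //.
  rewrite (_ : (0 * 2 + (2 - 0 - 2))%N = 0%N) //.
  rewrite (_ : (1 * 1 + (2 - 1 - 1))%N = 1%N) // s0 s1 !mulr1 mulN1r.
  rewrite scale1r scaleN1r scaleNr mulN1r.
  have [->|qN] := eqVneq q (i + j - 1).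
    by rewrite dg_leibniz addrA addNr add0r subrr.
  rewrite (glin_deg _ (dg_mul _ _ _ _)) // !dg_mul_deg ?scaler0 ?oppr0 ?addr0 //.
    by rewrite addrA.
  by rewrite addrAC.
- rewrite /insertion unlock /= /happ !dc !dn /= e2 !addr0 !mulr0 !mul0r.
  rewrite (_ : (0 * 2 + (3 - 0 - 2))%N = 1%N) //.
  rewrite (_ : (1 * 2 + (3 - 1 - 2))%N = 2%N) // s0 s1 s2 !mulr1.
  rewrite ?linear0 ?scaler0 ?add0r ?addr0 scale1r scaleN1r.
  have [->|qN] := eqVneq q (i + j + l); first by rewrite dg_mulA addNr.
  by rewrite !dg_mul_deg ?oppr0 ?addr0 // addrA.
Qed.

Lemma dg_is_Ainfty : is_Ainfty op.
Proof.
split; last exact: dg_op_relation.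
by split; [exact: dg_op_multilinear | exact: dg_op_degree].
Qed.

Definition dg_Ainfty : Ainfty A := MkAinfty dg_is_Ainfty.

End DgAinfty.

Definition dg_homology (k : fieldType) (A : gvect k) (D : dgAlg A) : gvect k :=
  Ainfty_homology (dg_Ainfty D).

Record deformation_retract (k : fieldType) (A : gvect k) (D : dgAlg A)
    (p : glin A (dg_homology D) 0) (i : glin (dg_homology D) A 0)
    (h : glin A A 1) : Prop := {
  dr_p_chain : forall (n : int) (x : A n),
    p (n - 1) (n - 1) (dg_d D n (n - 1) x) = 0;
  dr_i_chain : forall (n : int) (x : dg_homology D n),
    dg_d D n (n - 1) (i n n x) = 0;
  dr_pi : forall (n : int) (x : dg_homology D n), p n n (i n n x) = x;
  dr_ip : forall (n : int) (x : A n),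
    x - i n n (p n n x) =
    dg_d D (n + 1) n (h n (n + 1) x) + h (n - 1) n (dg_d D n (n - 1) x);
  dr_hh : forall (n : int) (x : A n), h (n + 1) (n + 1 + 1) (h n (n + 1) x) = 0;
  dr_ph : forall (n : int) (x : A n), p (n + 1) (n + 1) (h n (n + 1) x) = 0;
  dr_hi : forall (n : int) (x : dg_homology D n), h n (n + 1) (i n n x) = 0;
  dr_repr : forall (n : int) (x : dg_homology D n),
    hclass (m1 (dg_Ainfty D)) (i n n x) = x }.

Arguments deformation_retract {k A} D p i h.

Section Lambda.
Variables (k : fieldType) (A : gvect k) (D : dgAlg A) (h : glin A A 1).

(* the maps h lambda_n, with the convention h lambda_1 = - id *)
Definition hcomp (lam : gfam A A) : gfam A A := fun v q =>
  if size v == 1 then - gfam_id v q else h (q - 1) q (lam v (q - 1)).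

(* sum_(k+l = n) (-1)^(k(l+1)) nu (f_k (x) f_l), for f_n of degree n - 1 *)
Definition mul_split (f : gfam A A) : gfam A A := fun v q =>
  \sum_(1 <= a < size v)
    let l := (size v - a)%N in
    (sgn k (a * (l + 1))%N * sgn k ((l%:Z - 1) * degs (take a v))) *:
    dg_mul D q (tagged (happ (-1) f (take a v))) (tagged (happ (-1) f (drop a v))).

Fixpoint lambda_rec (fuel : nat) : gfam A A := fun v q =>
  if fuel is fuel'.+1 then
    if v is [:: x; y] then dg_mul D q (tagged x) (tagged y)
    else mul_split (hcomp (lambda_rec fuel')) v q
  else 0.

(* The fuel is sufficient: see lambdaE. *)
Definition lambda : gfam A A := fun v q => lambda_rec (size v) v q.

Lemma lambda2 (x y : homog A) q :
  lambda [:: x; y] q = dg_mul D q (tagged x) (tagged y).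
Proof. by []. Qed.

Lemma lambda_rec_stable (n n' : nat) (v : seq (homog A)) q :
  (size v <= n)%N -> (size v <= n')%N ->
  lambda_rec n v q = lambda_rec n' v q.
Proof.
elim: n n' v q => [|n IHn] [|n'] v q //.
- by case: v => //= _ _; rewrite /mul_split big_nil.
- by case: v => //= _ _; rewrite /mul_split big_nil.
move=> vn vn' /=.
suff E : mul_split (hcomp (lambda_rec n)) v q =
         mul_split (hcomp (lambda_rec n')) v q.
  by case: v vn vn' E => [|x [|y [|z v]]].
rewrite /mul_split big_nat [RHS]big_nat; apply: eq_bigr => a /andP[a0 av].
have E w q' : (size w < size v)%N ->
    hcomp (lambda_rec n) w q' = hcomp (lambda_rec n') w q'.
  move=> wv; rewrite /hcomp; case: ifP => // _; congr (h _ _ _).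
  by apply: IHn; rewrite -ltnS; apply: leq_trans wv _.
by rewrite /= !E // ?size_drop ?size_take ?av //; lia.
Qed.

Lemma lambdaE (v : seq (homog A)) q : (2 < size v)%N ->
  lambda v q = mul_split (hcomp lambda) v q.
Proof.
move=> v2; rewrite /lambda.
case E: (size v) v2 => [//|n] v2.
have -> : lambda_rec n.+1 v q = mul_split (hcomp (lambda_rec n)) v q.
  by move: E v2; case: v => [|x [|y [|z v]]] //= [<-].
rewrite /mul_split big_nat [RHS]big_nat; apply: eq_bigr => a /andP[a0 av].
have E' w q' : (size w < size v)%N ->
    hcomp (lambda_rec n) w q' = hcomp (fun v q => lambda_rec (size v) v q) w q'.
  move=> wv; rewrite /hcomp; case: ifP => // _; congr (h _ _ _).
  by apply: lambda_rec_stable => //; rewrite -ltnS -E.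
by rewrite /= !E' // ?size_drop ?size_take ?av //; lia.
Qed.

End Lambda.

Section Transfer.
Variables (k : fieldType) (A : gvect k) (D : dgAlg A).
Variables (p : glin A (dg_homology D) 0) (i : glin (dg_homology D) A 0).
Variable h : glin A A 1.

Local Notation H := (dg_homology D).

Definition incl_all (v : seq (homog H)) : seq (homog A) :=
  [seq Tagged A (i (tag x) (tag x) (tagged x)) | x <- v].

Definition transfer_op : gfam H H := fun v q =>
  if (size v < 2)%N then 0 else p q q (lambda D h (incl_all v) q).

Definition transfer_incl : gfam H A := fun v q =>
  if v is [:: x] then i (tag x) q (tagged x)
  else - h (q - 1) q (lambda D h (incl_all v) (q - 1)).

End Transfer.

Arguments transfer_op {k A} D p i h.
Arguments transfer_incl {k A} D i h.

(* Main.v *)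
From HB Require Import structures.
From mathcomp Require Import all_boot all_order all_algebra generic_quotient.
From mathcomp Require Import boolp zify ring.
Require Import Defs.

(* Up to signs, an A-infinity structure m on H is a coderivation B of the tensor
   coalgebra of the suspension sH, and an A-infinity morphism from H to the
   dg-algebra A is a Maurer-Cartan element of the convolution algebra of maps
   from that coalgebra to A, namely a map x with x B = d x + x * x.

   Existence. The maps i_n form I = i - h T with T = I * I, and m = p T. Put
   Phi = d I + T - I B. The retract identities and associativity of * give
   Phi = h (d T + T B) = h (Phi * I - I * Phi), so Phi = 0 by induction on the
   length of the argument; this says that I is a morphism. Then
   d T + T B = 0, and m B = p T B = - p d T = 0 is the A-infinity relation.

   Uniqueness. Let x be the Maurer-Cartan element of another minimal model. It
   is gauge equivalent, through some 1 + g with g = h E found by recursion on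
   the length, to an element t with h t = 0. For such a t the Maurer-Cartan
   equation becomes t = i p t - h (t * t), which is also the recursion satisfied
   by the composite of I with the family p t. Hence t is this composite, p t is
   a morphism to the transferred structure, and its first component is the
   identity, so that it is invertible. *)

Set Implicit Arguments.
Unset Strict Implicit.
Unset Printing Implicit Defensive.

Import GRing.Theory.
Local Open Scope ring_scope.
Local Open Scope quotient_scope.

(** * Sums over the cuts of a word *)

Section SplitSums.
Variable T : Type.
Implicit Types (v a b c : seq T).

(** Cuts of a word are summed by structural recursion on lists, so that coassociativity and the
    interplay of cuts with block decompositions are plain inductions instead of reindexings. The
    sign twist [hat] replaces the signs depending on arities by Koszul signs of the suspension; the
    argument is then algebra in a module of families. These families vanish on the empty word, so a
    product evaluates its factors on strictly shorter words: this drives the inductions on length. A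
    minimal structure has m_1 = 0, so its coderivation also shortens words, and the recursion for
    the gauge parameter relies on it. The identity T = I * I comes from the convention h lambda_1 =
    - id: every h lambda_n i^n is then minus i_n, and in a product the two minus signs cancel. The
    condition h t = 0 is imposed because a general Maurer-Cartan element need not be determined by
    its image under p, whereas a gauge-fixed one is. *)

Fixpoint splitsum (U : nmodType) v (F : seq T -> seq T -> U) : U :=
  if v is x :: v' then F [::] v + splitsum v' (fun a b => F (x :: a) b)
  else F [::] [::].

Definition splitsum3 (U : nmodType) v (F : seq T -> seq T -> seq T -> U) : U :=
  splitsum v (fun a bc => splitsum bc (F a)).

Lemma splitsumE (U : nmodType) v (F : seq T -> seq T -> U) :
  splitsum v F = \sum_(0 <= a < (size v).+1) F (take a v) (drop a v).
Proof.
elim: v F => [|x v IHv] F /=; first by rewrite big_nat1.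
by rewrite big_nat_recl //= IHv.
Qed.

Lemma eq_splitsum (U : nmodType) v (F G : seq T -> seq T -> U) :
  (forall a b, a ++ b = v -> F a b = G a b) -> splitsum v F = splitsum v G.
Proof.
move=> FG; rewrite !splitsumE; apply: eq_bigr => a _.
by apply: FG; rewrite cat_take_drop.
Qed.

Lemma splitsum0 (U : nmodType) v (F : seq T -> seq T -> U) :
  (forall a b, a ++ b = v -> F a b = 0) -> splitsum v F = 0.
Proof.
by move=> F0; rewrite splitsumE big1 // => a _; apply: F0; rewrite cat_take_drop.
Qed.

Lemma splitsumD (U : nmodType) v (F G : seq T -> seq T -> U) :
  splitsum v (fun a b => F a b + G a b) = splitsum v F + splitsum v G.
Proof. by rewrite !splitsumE big_split. Qed.

Lemma splitsum_raddf (U U' : nmodType) (g : {additive U -> U'}) v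
    (F : seq T -> seq T -> U) :
  splitsum v (fun a b => g (F a b)) = g (splitsum v F).
Proof. by rewrite !splitsumE raddf_sum. Qed.

Lemma splitsum_cat (U : nmodType) a (u : T) c (F : seq T -> seq T -> U) :
  splitsum (a ++ u :: c) F = splitsum a (fun a1 a2 => F a1 (a2 ++ u :: c)) +
                             splitsum c (fun c1 c2 => F (a ++ u :: c1) c2).
Proof. by elim: a F => [|x a IHa] F //=; rewrite IHa addrA. Qed.

(** Coassociativity of deconcatenation. *)
Lemma splitsumA (U : nmodType) v (F : seq T -> seq T -> seq T -> U) :
  splitsum v (fun ab c => splitsum ab (fun a b => F a b c)) = splitsum3 v F.
Proof.
rewrite /splitsum3; elim: v F => [|x v IHv] F //=.
by rewrite splitsumD IHv addrA.
Qed.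

Lemma eq_splitsum3 (U : nmodType) v (F G : seq T -> seq T -> seq T -> U) :
  (forall a b c, a ++ b ++ c = v -> F a b c = G a b c) ->
  splitsum3 v F = splitsum3 v G.
Proof.
move=> FG; apply: eq_splitsum => a bc abc; apply: eq_splitsum => b c bcE.
by apply: FG; rewrite bcE.
Qed.

Lemma splitsum3D (U : nmodType) v (F G : seq T -> seq T -> seq T -> U) :
  splitsum3 v (fun a b c => F a b c + G a b c) = splitsum3 v F + splitsum3 v G.
Proof.
by rewrite /splitsum3 -splitsumD; apply: eq_splitsum => a b _; rewrite splitsumD.
Qed.

Lemma splitsum30 (U : nmodType) v (F : seq T -> seq T -> seq T -> U) :
  (forall a b c, a ++ b ++ c = v -> F a b c = 0) -> splitsum3 v F = 0.
Proof.
move=> F0; apply: splitsum0 => a bc abc; apply: splitsum0 => b c bcE.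
by apply: F0; rewrite bcE.
Qed.

Lemma splitsum3_raddf (U U' : nmodType) (g : {additive U -> U'}) v
    (F : seq T -> seq T -> seq T -> U) :
  splitsum3 v (fun a b c => g (F a b c)) = g (splitsum3 v F).
Proof.
by rewrite -splitsum_raddf; apply: eq_splitsum => a b _; rewrite splitsum_raddf.
Qed.

Lemma splitsum3_cat (U : nmodType) a (u : T) c
    (F : seq T -> seq T -> seq T -> U) :
  splitsum3 (a ++ u :: c) F =
    splitsum3 a (fun a1 a2 a3 => F a1 a2 (a3 ++ u :: c)) +
    splitsum a (fun a1 a2 => splitsum c (fun c1 c2 => F a1 (a2 ++ u :: c1) c2)) +
    splitsum3 c (fun c1 c2 c3 => F (a ++ u :: c1) c2 c3).
Proof.
rewrite /splitsum3 splitsum_cat; congr (_ + _).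
by rewrite -splitsumD; apply: eq_splitsum => a1 a2 _; rewrite splitsum_cat.
Qed.

Lemma splitsum_exchange (U : nmodType) v v'
    (F : seq T -> seq T -> seq T -> seq T -> U) :
  splitsum v (fun a b => splitsum v' (fun a' b' => F a b a' b')) =
  splitsum v' (fun a' b' => splitsum v (fun a b => F a b a' b')).
Proof.
by elim: v F => [|x v IHv] F //=; rewrite IHv -splitsumD.
Qed.

Lemma splitsum3_left (U : nmodType) v
    (F : seq T -> seq T -> seq T -> seq T -> U) :
  splitsum3 v (fun a b c => splitsum a (fun a1 a2 => F a1 a2 b c)) =
  splitsum v (fun a1 r => splitsum3 r (F a1)).
Proof.
rewrite -[RHS]splitsumA; apply: eq_splitsum => a bc _.
by rewrite splitsum_exchange.
Qed.

Lemma splitsum3_right (U : nmodType) v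
    (F : seq T -> seq T -> seq T -> seq T -> U) :
  splitsum3 v (fun a b c => splitsum c (fun c1 c2 => F a b c1 c2)) =
  splitsum v (fun r c2 => splitsum3 r (fun a b c1 => F a b c1 c2)).
Proof.
rewrite [RHS]splitsumA; apply: eq_splitsum => a bc _.
by rewrite splitsumA.
Qed.

(** Both sides run over the decompositions into five pieces; the three middle ones are regrouped.
    This exchanges an operation on the middle piece with one that encloses it. *)
Lemma splitsum3_mid (U : nmodType) v
    (F : seq T -> seq T -> seq T -> seq T -> seq T -> U) :
  splitsum3 v (fun a b c => splitsum a (fun a1 a2 =>
    splitsum c (fun c1 c2 => F a1 a2 b c1 c2))) =
  splitsum3 v (fun a1 m c2 => splitsum3 m (fun a2 b c1 => F a1 a2 b c1 c2)).
Proof.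
rewrite splitsum3_left; apply: eq_splitsum => a1 r _.
by rewrite splitsum3_right.
Qed.

Lemma splitsum_nill (U : nmodType) v (F : seq T -> seq T -> U) :
  (forall x a b, F (x :: a) b = 0) -> splitsum v F = F [::] v.
Proof. by case: v => //= x v F0; rewrite splitsum0 ?addr0. Qed.

Lemma splitsum_nilr (U : nmodType) v (F : seq T -> seq T -> U) :
  (forall a x b, F a (x :: b) = 0) -> splitsum v F = F v [::].
Proof. by elim: v F => //= x v IHv F F0; rewrite F0 add0r IHv. Qed.

End SplitSums.

Lemma splitsum_map (T T' : Type) (U : nmodType) (g : T' -> T) (w : seq T')
    (F : seq T -> seq T -> U) :
  splitsum (map g w) F = splitsum w (fun a b => F (map g a) (map g b)).
Proof. by elim: w F => [|x w IHw] F //=; rewrite IHw. Qed.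

Lemma splitsum3_map (T T' : Type) (U : nmodType) (g : T' -> T) (w : seq T')
    (F : seq T -> seq T -> seq T -> U) :
  splitsum3 (map g w) F = splitsum3 w (fun a b c => F (map g a) (map g b) (map g c)).
Proof.
by rewrite /splitsum3 splitsum_map; apply: eq_splitsum => a b _; rewrite splitsum_map.
Qed.

(** * Sums over decompositions into nonempty blocks *)

Section BlockSums.
Variable T : Type.
Implicit Types (v a b c : seq T).

(* sum over the decompositions of [v] into nonempty consecutive blocks *)
Fixpoint blocksum (U : nmodType) v (F : seq (seq T) -> U) : U :=
  if v is x :: v' then
    blocksum v' (fun ws => F ([:: x] :: ws) +
                           if ws is w :: ws' then F ((x :: w) :: ws') else 0)
  else F [::].

Lemma eq_blocksum (U : nmodType) v (F G : seq (seq T) -> U) :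
  (forall ws, flatten ws = v -> all (fun w => 0 < size w)%N ws -> F ws = G ws) ->
  blocksum v F = blocksum v G.
Proof.
elim: v F G => [|x v IHv] F G FG /=; first exact: FG.
apply: IHv => ws wsv wsP; rewrite FG /= ?wsv //.
case: ws wsv wsP => [|w ws] // wsv /= /andP[_ wsP].
by rewrite FG //= -wsv.
Qed.

Lemma blocksumD (U : nmodType) v (F G : seq (seq T) -> U) :
  blocksum v (fun ws => F ws + G ws) = blocksum v F + blocksum v G.
Proof.
elim: v F G => [|x v IHv] F G //=; rewrite -IHv.
by apply: eq_blocksum => -[|w ws] _ _; rewrite ?addr0 // addrACA.
Qed.

Lemma blocksum_raddf (U U' : nmodType) (g : {additive U -> U'}) v
    (F : seq (seq T) -> U) :
  blocksum v (fun ws => g (F ws)) = g (blocksum v F).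
Proof.
elim: v F => [|x v IHv] F //=; rewrite -IHv.
by apply: eq_blocksum => -[|w ws] _ _; rewrite !raddfD ?raddf0.
Qed.

Lemma blocksum0 (U : nmodType) v (F : seq (seq T) -> U) :
  (forall ws, flatten ws = v -> all (fun w => 0 < size w)%N ws -> F ws = 0) ->
  blocksum v F = 0.
Proof.
move=> F0; rewrite (@eq_blocksum _ _ _ (fun _ => 0)) //.
elim: v {F F0} => [|x v IHv] //=.
by rewrite -[RHS]IHv; apply: eq_blocksum => -[|w ws] _ _; rewrite addr0.
Qed.

Lemma splitsum_blocksum (T' : Type) (U : nmodType) v (w : seq T')
    (F : seq T' -> seq T' -> seq (seq T) -> U) :
  splitsum w (fun w1 w2 => blocksum v (F w1 w2)) =
  blocksum v (fun ws => splitsum w (fun w1 w2 => F w1 w2 ws)).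
Proof. by elim: w F => [|x w IHw] F //=; rewrite IHw -blocksumD. Qed.

Lemma splitsum3_blocksum (T' : Type) (U : nmodType) v (w : seq T')
    (F : seq T' -> seq T' -> seq T' -> seq (seq T) -> U) :
  splitsum3 w (fun w1 w2 w3 => blocksum v (F w1 w2 w3)) =
  blocksum v (fun ws => splitsum3 w (fun w1 w2 w3 => F w1 w2 w3 ws)).
Proof.
rewrite /splitsum3 -splitsum_blocksum; apply: eq_splitsum => w1 w' _.
exact: splitsum_blocksum.
Qed.

Lemma blocksum_exchange (U : nmodType) v v' (F : seq (seq T) -> seq (seq T) -> U) :
  blocksum v (fun ws => blocksum v' (F ws)) =
  blocksum v' (fun ws' => blocksum v (fun ws => F ws ws')).
Proof.
elim: v F => [|x v IHv] F //=; rewrite -IHv.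
apply: eq_blocksum => -[|w ws] _ _; last by rewrite blocksumD.
by rewrite addr0; apply: eq_blocksum => ws' _ _; rewrite addr0.
Qed.

(** Cutting a sequence of blocks between two of them cuts the word itself. This is why a family
    induces a map compatible with deconcatenation. *)
Lemma blocksum_splitsum (U : nmodType) v (G : seq (seq T) -> seq (seq T) -> U) :
  blocksum v (fun ws => splitsum ws G) =
  splitsum v (fun a b => blocksum a (fun wa => blocksum b (G wa))).
Proof.
elim: v G => [|x v IHv] G //=.
pose G' (p q : seq (seq T)) := if p is w :: p' then G ((x :: w) :: p') q else 0.
transitivity (blocksum v (fun ws =>
    (G [::] ([:: x] :: ws) + if ws is w :: ws' then G [::] ((x :: w) :: ws') else 0)
    + splitsum ws (fun p q => G ([:: x] :: p) q + G' p q))).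
  apply: eq_blocksum => -[|w ws] _ _ /=; first by rewrite !addr0.
  by rewrite splitsumD addr0 addrACA; congr (_ + _); rewrite addrA.
rewrite blocksumD IHv; congr (_ + _).
apply: eq_splitsum => a b _; apply: eq_blocksum => -[|w wa] _ _ /=.
  by rewrite blocksumD [X in _ + X]blocksum0.
by rewrite blocksumD.
Qed.

Lemma blocksum_splitsum3 (U : nmodType) v
    (G : seq (seq T) -> seq (seq T) -> seq (seq T) -> U) :
  blocksum v (fun ws => splitsum3 ws G) =
  splitsum3 v (fun a b c =>
    blocksum a (fun wa => blocksum b (fun wb => blocksum c (G wa wb)))).
Proof.
rewrite blocksum_splitsum; apply: eq_splitsum => a bc _.
rewrite splitsum_blocksum; apply: eq_blocksum => wa _ _.
exact: blocksum_splitsum.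
Qed.

Lemma blocksum_first (U : nmodType) v (F : seq (seq T) -> U) :
  blocksum v F = (if v is [::] then F [::] else 0) +
    splitsum v (fun a b => if a is [::] then 0 else blocksum b (fun ws => F (a :: ws))).
Proof.
elim: v F => [|x v IHv] F /=; first by rewrite addr0.
rewrite !add0r blocksumD [in X in _ + X]IHv.
case: v {IHv} => [|y v] //=; rewrite ?add0r ?addr0 //.
Qed.

(** Exactly one block contains the marked letter [u]; [a2] and [c1] are the parts of that block on
    either side of it. *)
Lemma blocksum_cat (U : nmodType) a (u : T) c (F : seq (seq T) -> U) :
  blocksum (a ++ u :: c) F =
  splitsum a (fun a1 a2 => splitsum c (fun c1 c2 =>
    blocksum a1 (fun w1 => blocksum c2 (fun w2 =>
      F (w1 ++ (a2 ++ u :: c1) :: w2))))).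
Proof.
elim: a F => [|x a IHa] F.
  by rewrite [LHS]blocksum_first /= !add0r.
(* The empty sequence of blocks decomposes only the empty word, so a single cut survives. *)
have delta (K : seq T -> U) a' :
    splitsum a' (fun a1 a2 =>
      blocksum a1 (fun w1 => if w1 is [::] then K a2 else 0)) = K a'.
  elim: a' => [|y a' IHa'] //=; rewrite [X in _ + X]splitsum0 ?addr0 // => a1 b1 _.
  by apply: blocksum0 => -[|w ws] _ _; rewrite addr0.
rewrite /= IHa.
transitivity (
  splitsum a (fun a1 a2 => blocksum a1 (fun w1 =>
    if w1 is [::] then splitsum c (fun c1 c2 =>
      blocksum c2 (fun w2 => F ((x :: a2 ++ u :: c1) :: w2))) else 0)) +
  splitsum a (fun a1 a2 => splitsum c (fun c1 c2 =>
    blocksum a1 (fun w1 => blocksum c2 (fun w2 =>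
      F ([:: x] :: w1 ++ (a2 ++ u :: c1) :: w2) +
      if w1 is w :: w1' then F ((x :: w) :: w1' ++ (a2 ++ u :: c1) :: w2)
      else 0))))).
  rewrite -splitsumD; apply: eq_splitsum => a1 a2 _.
  rewrite !splitsum_blocksum -blocksumD; apply: eq_blocksum => -[|w w1] _ _ /=.
    rewrite -splitsumD; apply: eq_splitsum => c1 c2 _.
    by rewrite -blocksumD; apply: eq_blocksum => w2 _ _; rewrite addr0 addrC.
  by rewrite add0r.
rewrite delta; congr (_ + _); apply: eq_splitsum => a1 a2 _.
apply: eq_splitsum => c1 c2 _; apply: eq_blocksum => -[|w w1] _ _.
  by rewrite addr0; apply: eq_blocksum => w2 _ _; rewrite addr0.
by rewrite blocksumD.
Qed.

Lemma flatten_size_le (ws : seq (seq T)) :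
  all (fun w => 0 < size w)%N ws -> (size ws <= size (flatten ws))%N.
Proof.
elim: ws => //= w ws IHws /andP[w0 /IHws]; rewrite size_cat; lia.
Qed.

(** The decomposition into single letters is the only one with as many blocks as letters. *)
Lemma blocksum_top (U : nmodType) v (F : seq (seq T) -> U) :
  (forall ws, flatten ws = v -> all (fun w => 0 < size w)%N ws ->
     (size ws < size v)%N -> F ws = 0) ->
  blocksum v F = F [seq [:: x] | x <- v].
Proof.
elim: v F => [|x v IHv] F F0 //=.
rewrite -(IHv (fun ws => F ([:: x] :: ws))); last first.
  by move=> ws wsv wsP wsl; apply: F0; rewrite //= wsv.
apply: eq_blocksum => -[|w ws] wsv wsP; first by rewrite addr0.
rewrite [X in _ + X]F0 ?addr0 //=; first by rewrite -wsv.
  by case/andP: wsP.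
by rewrite ltnS -wsv; apply: (@flatten_size_le (w :: ws)).
Qed.

End BlockSums.

(** * Signs, and linearity of the sums *)

Section Signs.
Variable k : fieldType.

Lemma sgnD (z z' : int) : sgn k (z + z') = sgn k z * sgn k z'.
Proof. by rewrite /sgn expfzDr // oppr_eq0 oner_eq0. Qed.

Lemma sgn0 : sgn k 0 = 1. Proof. by []. Qed.

Lemma sgnN1 : sgn k (-1) = -1.
Proof. by rewrite /sgn exprN1 invrN1. Qed.

Lemma sgn_even (z : int) : sgn k (2 * z) = 1.
Proof. by rewrite /sgn -exprz_exp -exprnP sqrrN expr1n exp1rz. Qed.

(** Half the difference of the exponents is an explicit argument, so that comparing signs reduces to
    a ring identity of integers. *)
Lemma sgn_mod2 (c z z' : int) : z = z' + 2 * c -> sgn k z = sgn k z'.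
Proof. by move=> ->; rewrite sgnD sgn_even mulr1. Qed.

Lemma sgn_odd (c z z' : int) : z = z' + 1 + 2 * c -> sgn k z = - sgn k z'.
Proof. by move=> ->; rewrite sgnD sgn_even mulr1 sgnD mulrN1. Qed.

Lemma sgn_sqr (z : int) : sgn k z * sgn k z = 1.
Proof. by rewrite -sgnD (sgn_mod2 (c := z) (z' := 0)) //; ring. Qed.

End Signs.

Arguments sgn_mod2 {k} c {z z'}.
Arguments sgn_odd {k} c {z z'}.

Section LinearSums.
Variables (k : fieldType) (T : Type).

Lemma splitsumZ (U : lmodType k) (c : k) (v : seq T) (F : seq T -> seq T -> U) :
  splitsum v (fun a b => c *: F a b) = c *: splitsum v F.
Proof. exact: (splitsum_raddf (GRing.scale c)). Qed.

Lemma splitsum3Z (U : lmodType k) (c : k) (v : seq T)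
    (F : seq T -> seq T -> seq T -> U) :
  splitsum3 v (fun a b d => c *: F a b d) = c *: splitsum3 v F.
Proof. exact: (splitsum3_raddf (GRing.scale c)). Qed.

Lemma blocksumZ (U : lmodType k) (c : k) (v : seq T) (F : seq (seq T) -> U) :
  blocksum v (fun ws => c *: F ws) = c *: blocksum v F.
Proof. exact: (blocksum_raddf (GRing.scale c)). Qed.

Variables (X : lmodType k) (U : lmodType k).

Lemma splitsum_linear (v : seq T) (F : X -> seq T -> seq T -> U) :
  (forall a b, linear (fun x => F x a b)) -> linear (fun x => splitsum v (F x)).
Proof.
move=> Fl c x y; rewrite -splitsumZ -splitsumD.
by apply: eq_splitsum => a b _; apply: Fl.
Qed.

Lemma splitsum3_linear (v : seq T) (F : X -> seq T -> seq T -> seq T -> U) :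
  (forall a b c, linear (fun x => F x a b c)) -> linear (fun x => splitsum3 v (F x)).
Proof.
move=> Fl; apply: splitsum_linear => a bc.
exact: (@splitsum_linear bc (fun x => F x a)).
Qed.

Lemma blocksum_linear (v : seq T) (F : X -> seq (seq T) -> U) :
  (forall ws, linear (fun x => F x ws)) -> linear (fun x => blocksum v (F x)).
Proof.
move=> Fl c x y; rewrite -blocksumZ -blocksumD.
by apply: eq_blocksum => ws _ _; apply: Fl.
Qed.

Lemma scale_linear (c : k) (F : X -> U) : linear F -> linear (fun x => c *: F x).
Proof. by move=> Fl a x y; rewrite Fl scalerDr !scalerA mulrC. Qed.

Lemma add_linear (F G : X -> U) :
  linear F -> linear G -> linear (fun x => F x + G x).
Proof. by move=> Fl Gl a x y; rewrite Fl Gl scalerDr addrACA. Qed.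

End LinearSums.

Lemma comp_linear (k : fieldType) (X Y U : lmodType k) (G : Y -> U) (F : X -> Y) :
  linear G -> linear F -> linear (fun x => G (F x)).
Proof. by move=> Gl Fl a x y; rewrite Fl Gl. Qed.

Lemma linear_zero (k : fieldType) (X U : lmodType k) (F : X -> U) : linear F -> F 0 = 0.
Proof. by move=> Fl; have := Fl (-1) 0 0; rewrite scaler0 addr0 scaleN1r addNr. Qed.

Section LinearMaps.
Variables (k : fieldType) (X U : lmodType k) (F : X -> U).
Hypothesis Fl : linear F.

Lemma linear_add x y : F (x + y) = F x + F y.
Proof. by have := Fl 1 x y; rewrite !scale1r. Qed.

Lemma linear_scale c x : F (c *: x) = c *: F x.
Proof. by have := Fl c x 0; rewrite (linear_zero Fl) !addr0. Qed.

Lemma linear_splitsum (T : Type) (v : seq T) (G : seq T -> seq T -> X) :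
  F (splitsum v G) = splitsum v (fun a b => F (G a b)).
Proof. by elim: v G => [|x v IHv] G //=; rewrite linear_add IHv. Qed.

Lemma linear_splitsum3 (T : Type) (v : seq T) (G : seq T -> seq T -> seq T -> X) :
  F (splitsum3 v G) = splitsum3 v (fun a b c => F (G a b c)).
Proof.
rewrite /splitsum3 linear_splitsum; apply: eq_splitsum => a b _.
exact: linear_splitsum.
Qed.

Lemma linear_blocksum (T : Type) (v : seq T) (G : seq (seq T) -> X) :
  F (blocksum v G) = blocksum v (fun ws => F (G ws)).
Proof.
elim: v G => [|x v IHv] G //=; rewrite IHv; apply: eq_blocksum => -[|w ws] _ _.
  by rewrite !addr0.
exact: linear_add.
Qed.

End LinearMaps.

(** * The module of families; degrees and recursion on length *)

Section GfamModule.
Variables (k : fieldType) (V W : gvect k).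

Lemma gfamP (f g : gfam V W) : (forall v q, f v q = g v q) -> f = g.
Proof.
move=> fg; apply: functional_extensionality_dep => v.
exact: functional_extensionality_dep.
Qed.

HB.instance Definition _ := gen_eqMixin (gfam V W).
HB.instance Definition _ := gen_choiceMixin (gfam V W).

Definition gfam_zero : gfam V W := fun _ _ => 0.
Definition gfam_opp (f : gfam V W) : gfam V W := fun v q => - f v q.
Definition gfam_add (f g : gfam V W) : gfam V W := fun v q => f v q + g v q.
Definition gfam_scale (a : k) (f : gfam V W) : gfam V W := fun v q => a *: f v q.

Fact gfam_addA : associative gfam_add.
Proof. by move=> f g l; apply: gfamP => v q; apply: addrA. Qed.
Fact gfam_addC : commutative gfam_add.
Proof. by move=> f g; apply: gfamP => v q; apply: addrC. Qed.
Fact gfam_add0 : left_id gfam_zero gfam_add.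
Proof. by move=> f; apply: gfamP => v q; apply: add0r. Qed.
Fact gfam_addN : left_inverse gfam_zero gfam_opp gfam_add.
Proof. by move=> f; apply: gfamP => v q; apply: addNr. Qed.

HB.instance Definition _ :=
  GRing.isZmodule.Build (gfam V W) gfam_addA gfam_addC gfam_add0 gfam_addN.

Fact gfam_scalerA a b f : gfam_scale a (gfam_scale b f) = gfam_scale (a * b) f.
Proof. by apply: gfamP => v q; apply: scalerA. Qed.
Fact gfam_scale1r : left_id 1 gfam_scale.
Proof. by move=> f; apply: gfamP => v q; apply: scale1r. Qed.
Fact gfam_scalerDr : right_distributive gfam_scale +%R.
Proof. by move=> a f g; apply: gfamP => v q; apply: scalerDr. Qed.
Fact gfam_scalerDl f : {morph gfam_scale^~ f : a b / a + b}.
Proof. by move=> a b; apply: gfamP => v q; apply: scalerDl. Qed.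

HB.instance Definition _ := GRing.Zmodule_isLmodule.Build k (gfam V W)
  gfam_scalerA gfam_scale1r gfam_scalerDr gfam_scalerDl.

Lemma gfamDE (f g : gfam V W) v q : (f + g) v q = f v q + g v q. Proof. by []. Qed.
Lemma gfamNE (f : gfam V W) v q : (- f) v q = - f v q. Proof. by []. Qed.
Lemma gfamZE a (f : gfam V W) v q : (a *: f) v q = a *: f v q. Proof. by []. Qed.
Lemma gfam0E v q : (0 : gfam V W) v q = 0. Proof. by []. Qed.
Definition gfamE := (gfamDE, gfamNE, gfamZE, gfam0E).

End GfamModule.

Section Degrees.
Variables (k : fieldType).

(* total degree in the tensor coalgebra of the suspension sV *)
Definition sdegs (V : gvect k) (v : seq (homog V)) : int := degs v + (size v)%:Z.

Section OneSpace.
Variable V : gvect k.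
Implicit Types v w : seq (homog V).

Lemma degs_nil : degs ([::] : seq (homog V)) = 0.
Proof. by rewrite /degs big_nil. Qed.
Lemma degs_cons x v : degs (x :: v) = tag x + degs v.
Proof. by rewrite /degs big_cons. Qed.
Lemma degs_cat v w : degs (v ++ w) = degs v + degs w.
Proof. by rewrite /degs big_cat. Qed.

Lemma sdegs_nil : sdegs ([::] : seq (homog V)) = 0.
Proof. by rewrite /sdegs degs_nil. Qed.
Lemma sdegs_cons x v : sdegs (x :: v) = tag x + 1 + sdegs v.
Proof. by rewrite /sdegs degs_cons /=; lia. Qed.
Lemma sdegs_cat v w : sdegs (v ++ w) = sdegs v + sdegs w.
Proof. by rewrite /sdegs degs_cat size_cat; lia. Qed.

End OneSpace.

Variables V W : gvect k.

Lemma tagged_at (x : forall q, W q) (q q' : int) :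
  q = q' -> Tagged W (x q) = Tagged W (x q').
Proof. by move=> ->. Qed.

Lemma tag_happ e (f : gfam V W) v : tag (happ e f v) = sdegs v + e.
Proof. by rewrite /= /sdegs addrA. Qed.

Lemma happ_at (q e : int) (f : gfam V W) v :
  q = sdegs v + e -> happ e f v = Tagged W (f v q).
Proof. by move=> ->; apply: tagged_at; rewrite /sdegs addrA. Qed.

Lemma sdegs_map_happ (f : gfam V W) (ws : seq (seq (homog V))) :
  sdegs [seq happ (-1) f w | w <- ws] = sdegs (flatten ws).
Proof.
elim: ws => [|w ws IHws] /=; first by rewrite !sdegs_nil.
by rewrite sdegs_cons sdegs_cat IHws tag_happ addrNK.
Qed.

(** Uniqueness for equations that express the value on a word through values on shorter words;
    [hfam_rec] is the matching existence statement. *)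
Lemma gfam_size_ind (f g : gfam V W) :
  (forall v, (forall w q, (size w < size v)%N -> f w q = g w q) ->
     forall q, f v q = g v q) -> f = g.
Proof.
move=> IH; apply: gfamP => v q; have [n] := ubnP (size v).
elim: n v q => // n IHn v q vn; apply: IH => w q' wv; apply: IHn; lia.
Qed.

(* A family of maps of degree [e] on the reduced tensor coalgebra of sV: for
   n >= 1 this is [is_gfam e], a map of degree n + e on the n-th tensor power of V
   having degree e on that of sV. *)
Record hfam (e : int) (f : gfam V W) : Prop := HFam {
  hfam_ml : forall v1 v2 i q, linear (fun x : V i => f (v1 ++ Tagged V x :: v2) q);
  hfam_deg : forall v q, q != sdegs v + e -> f v q = 0;
  hfam_nil : forall q, f [::] q = 0 }.

Lemma happ_nil e f : hfam e f -> happ e f [::] = Tagged W (0 : W e).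
Proof.
move=> hf; rewrite (happ_at (q := e)); last by rewrite sdegs_nil add0r.
by rewrite (hfam_nil hf).
Qed.

Lemma happ_linear (U : lmodType k) (G : homog W -> U) e f v1 v2 i : hfam e f ->
  (forall j, linear (fun y : W j => G (Tagged W y))) ->
  linear (fun x : V i => G (happ e f (v1 ++ Tagged V x :: v2))).
Proof.
move=> hf Gl.
(* The degree of the output depends only on the degrees of the letters, so it can be fixed before
   [x] varies. *)
pose q := sdegs v1 + (i + 1 + sdegs v2) + e.
have E (x : V i) : G (happ e f (v1 ++ Tagged V x :: v2)) =
           G (Tagged W (f (v1 ++ Tagged V x :: v2) q)).
  by rewrite (happ_at (q := q)) // sdegs_cat sdegs_cons.
move=> a x y; rewrite !E.
exact: (comp_linear (Gl q) (hfam_ml hf v1 v2 (i := i) q)).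
Qed.

Lemma hfam_zero (f : gfam V W) e v1 v2 i q :
  hfam e f -> f (v1 ++ Tagged V (0 : V i) :: v2) q = 0.
Proof. by move=> hf; apply: (linear_zero (hfam_ml hf v1 v2 (i := i) q)). Qed.

Lemma hfam0 e : hfam e (0 : gfam V W).
Proof. by split=> // v1 v2 i q a x y; rewrite !gfamE scaler0 addr0. Qed.

Lemma hfamD e f g : hfam e f -> hfam e g -> hfam e (f + g).
Proof.
move=> [fl fd f0] [gl gd g0]; split=> [v1 v2 i q|v q qN|q].
- exact: (add_linear (fl v1 v2 i q) (gl v1 v2 i q)).
- by rewrite gfamE fd // gd // addr0.
- by rewrite gfamE f0 g0 addr0.
Qed.

Lemma hfamZ e c f : hfam e f -> hfam e (c *: f).
Proof.
move=> [fl fd f0]; split=> [v1 v2 i q|v q qN|q].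
- exact: (scale_linear c (fl v1 v2 i q)).
- by rewrite gfamE fd // scaler0.
- by rewrite gfamE f0 scaler0.
Qed.

Lemma hfamN e f : hfam e f -> hfam e (- f).
Proof. by move=> hf; rewrite -scaleN1r; apply: hfamZ. Qed.

Lemma hfamB e f g : hfam e f -> hfam e g -> hfam e (f - g).
Proof. by move=> hf hg; apply: hfamD => //; apply: hfamN. Qed.

(** The iterates of [Th] from 0 are stable on words of length n after n + 1 steps, and the diagonal
    family is a fixed point. Locality is asked only on [hfam] arguments, because products are local
    only for factors vanishing on the empty word. *)
Lemma hfam_rec e (Th : gfam V W -> gfam V W) :
  (forall x, hfam e x -> hfam e (Th x)) ->
  (forall x y v q, hfam e x -> hfam e y ->
     (forall w q', (size w < size v)%N -> x w q' = y w q') ->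
     Th x v q = Th y v q) ->
  exists x, hfam e x /\ x = Th x.
Proof.
move=> Th_hfam Th_loc.
pose it n := iter n Th (0 : gfam V W).
have it_h n : hfam e (it n) by elim: n => [|n IHn]; [apply: hfam0 | apply: Th_hfam].
have it_st n m v q : (size v < n)%N -> (size v < m)%N -> it n v q = it m v q.
  elim: n m v q => // n IHn [] // m v q vn vm.
  by apply: Th_loc => // w q' wv; apply: IHn; lia.
pose x : gfam V W := fun v => it (size v).+1 v.
have hx : hfam e x.
  split=> [v1 v2 i q a y z|v q qN|q].
  - by rewrite /x !size_cat; apply: (hfam_ml (it_h (size v1 + (size v2).+1).+1)).
  - exact: (hfam_deg (it_h _)).
  - exact: (hfam_nil (it_h _)).
exists x; split=> //; apply: gfamP => v q; rewrite {1}/x /it iterS.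
apply: Th_loc => //; first exact: it_h.
by move=> w q' wv; apply: it_st; lia.
Qed.

End Degrees.

Arguments happ_at {k V W q e f v} _.

(** * Composition with linear maps and with coderivations *)

Section PostComposition.
Variables (k : fieldType) (V W W' : gvect k) (et : int) (t : glin W W' et).

Definition post (x : gfam V W) : gfam V W' :=
  fun v q => t (q - et) q (x v (q - et)).

Fact post_linear : linear post.
Proof. by move=> a x y; apply: gfamP => v q; rewrite /post !gfamE linearP. Qed.

HB.instance Definition _ :=
  GRing.isLinear.Build k (gfam V W) (gfam V W') *:%R post post_linear.

Lemma hfam_post e x : hfam e x -> hfam (e + et) (post x).
Proof.
move=> hx; split=> [v1 v2 i q a y z|v q qN|q].
- by rewrite /post (hfam_ml hx) linearP.
- by rewrite /post (hfam_deg hx) ?linear0 //; apply: contraNneq qN; lia.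
- by rewrite /post (hfam_nil hx) linear0.
Qed.

Lemma happ_post e x v :
  happ (e + et) (post x) v =
  Tagged W' (t (tag (happ e x v)) (tag (happ e x v) + et) (tagged (happ e x v))).
Proof.
rewrite /happ /post /=; set q := degs v + (_ + e).
rewrite (_ : degs v + ((size v)%:Z + (e + et)) = q + et); last by rewrite /q; lia.
by rewrite addrK.
Qed.

End PostComposition.

Section Insertion.
Variables (k : fieldType) (V : gvect k) (m : gfam V V).
Hypothesis hm : hfam (-2) m.

Section OneTarget.
Variable W : gvect k.

(* composition with the coderivation of the tensor coalgebra induced by [m] *)
Definition ins (m : gfam V V) (x : gfam V W) : gfam V W := fun v q =>
  splitsum3 v (fun a b c =>
    sgn k (sdegs a) *: x (a ++ happ (-2) m b :: c) q).

Fact ins_linear : linear (ins m).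
Proof.
move=> a x y; apply: gfamP => v q; rewrite /ins !gfamE -splitsum3Z -splitsum3D.
by apply: eq_splitsum3 => b c d _; rewrite !gfamE scalerDr !scalerA mulrC.
Qed.

HB.instance Definition _ :=
  GRing.isLinear.Build k (gfam V W) (gfam V W) *:%R (ins m) ins_linear.

Lemma hfam_ins e x : hfam e x -> hfam (e - 1) (ins m x).
Proof.
move=> hx; split=> [v1 v2 i q|v q qN|q].
(* The inserted block lies to the left of the marked letter, contains it, or lies to its right. *)
- rewrite /ins; have E (z : V i) := splitsum3_cat v1 (Tagged V z) v2
    (fun a b c => sgn k (sdegs a) *: x (a ++ happ (-2) m b :: c) q).
  suff: linear (fun z : V i =>
      splitsum3 v1 (fun a b c => sgn k (sdegs a) *:
        x ((a ++ happ (-2) m b :: c) ++ Tagged V z :: v2) q) +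
      splitsum v1 (fun a1 a2 => splitsum v2 (fun c1 c2 => sgn k (sdegs a1) *:
        x (a1 ++ happ (-2) m (a2 ++ Tagged V z :: c1) :: c2) q)) +
      splitsum3 v2 (fun a b c => sgn k (sdegs v1 + (i + 1 + sdegs a)) *:
        x (v1 ++ Tagged V z :: (a ++ happ (-2) m b :: c)) q)).
    move=> El a y z; have := El a y z; rewrite !E.
    have G (z' : V i) : splitsum3 v1 (fun a b c => sgn k (sdegs a) *:
        x ((a ++ happ (-2) m b :: c) ++ Tagged V z' :: v2) q) =
      splitsum3 v1 (fun a b c => sgn k (sdegs a) *:
        x (a ++ happ (-2) m b :: c ++ Tagged V z' :: v2) q).
      by apply: eq_splitsum3 => b1 b2 b3 _; rewrite -catA.
    have G' (z' : V i) : splitsum3 v2 (fun a b c =>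
        sgn k (sdegs v1 + (i + 1 + sdegs a)) *:
        x (v1 ++ Tagged V z' :: (a ++ happ (-2) m b :: c)) q) =
      splitsum3 v2 (fun a b c => sgn k (sdegs (v1 ++ Tagged V z' :: a)) *:
        x ((v1 ++ Tagged V z' :: a) ++ happ (-2) m b :: c) q).
      by apply: eq_splitsum3 => b1 b2 b3 _; rewrite -catA sdegs_cat sdegs_cons.
    by rewrite !G !G'.
  apply: add_linear; first apply: add_linear.
  - by apply: splitsum3_linear => a b c; apply: scale_linear; apply: (hfam_ml hx).
  - apply: splitsum_linear => a1 a2; apply: splitsum_linear => c1 c2.
    apply: scale_linear.
    apply: (happ_linear (G := fun u => x (a1 ++ u :: c2) q) a2 c1 (i := i) hm).
    by move=> j; apply: (hfam_ml hx).
  - by apply: splitsum3_linear => a b c; apply: scale_linear; apply: (hfam_ml hx).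
- apply: splitsum30 => a b c abc; rewrite (hfam_deg hx) ?scaler0 //.
  move: qN; rewrite -abc !sdegs_cat sdegs_cons tag_happ; apply: contraNneq; lia.
- rewrite /ins /splitsum3 /= happ_nil //.
  by rewrite (hfam_zero [::] [::] _ q hx) scaler0.
Qed.

End OneTarget.

(** Square of an odd coderivation: nested insertions assemble into [ins m m], and disjoint ones
    cancel in pairs, since exchanging their order changes the sign. *)
Lemma ins_ins W e (x : gfam V W) :
  ins m m = 0 -> hfam e x -> ins m (ins m x) = 0.
Proof.
move=> mm hx; apply: gfamP => v q; rewrite gfamE.
pose s (a : seq (homog V)) : k := sgn k (sdegs a); pose u b := happ (-2) m b.
transitivity (splitsum3 v (fun a b c => splitsum3 a (fun a1 a2 a3 =>
      (s a * s a1) *: x (a1 ++ u a2 :: a3 ++ u b :: c) q)) +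
    splitsum3 v (fun a b c => splitsum a (fun a1 a2 => splitsum c (fun c1 c2 =>
      (s (a1 ++ a2) * s a1) *: x (a1 ++ u (a2 ++ u b :: c1) :: c2) q))) +
    splitsum3 v (fun a b c => splitsum3 c (fun c1 c2 c3 =>
      (s a * s (a ++ u b :: c1)) *: x (a ++ u b :: c1 ++ u c2 :: c3) q))).
  rewrite -!splitsum3D; apply: eq_splitsum3 => a b c _.
  rewrite [ins _ _ _ _]/ins splitsum3_cat !scalerDr; congr (_ + _ + _).
  - by rewrite -splitsum3Z; apply: eq_splitsum3 => *; rewrite scalerA.
  - rewrite -splitsumZ; apply: eq_splitsum => a1 a2 <-; rewrite -splitsumZ.
    by apply: eq_splitsum => *; rewrite scalerA.
  - by rewrite -splitsum3Z; apply: eq_splitsum3 => *; rewrite scalerA -catA.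
rewrite [X in _ + X + _](_ : _ = 0) ?addr0; last first.
  rewrite (splitsum3_mid v (fun a1 a2 b c1 c2 =>
    (s (a1 ++ a2) * s a1) *: x (a1 ++ u (a2 ++ u b :: c1) :: c2) q)).
  apply: splitsum30 => a1 v' c2 _.
  have xl : linear (fun z => x (a1 ++ Tagged V z :: c2) q) :=
    hfam_ml hx a1 c2 (i := sdegs v' - 3) q.
  transitivity (x (a1 ++ Tagged V (ins m m v' (sdegs v' - 3)) :: c2) q).
    rewrite /ins (linear_splitsum3 xl); apply: eq_splitsum3 => a2 b c1 abc.
    rewrite (linear_scale xl) /u (happ_at (q := sdegs v' - 3)); last first.
      by rewrite -abc !sdegs_cat sdegs_cons tag_happ; lia.
    congr (_ *: _); rewrite /s -sgnD sdegs_cat.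
    by apply: (sgn_mod2 (sdegs a1)); ring.
  by rewrite mm gfamE (linear_zero xl).
(* Both sums now run over two disjoint blocks, [q'] to the left of [r2]. The right block is replaced
   first in the first sum, the left one in the second. *)
transitivity (
  splitsum3 v (fun p q' r => splitsum3 r (fun r1 r2 r3 =>
    (s (p ++ q' ++ r1) * s p) *: x (p ++ u q' :: r1 ++ u r2 :: r3) q)) +
  splitsum3 v (fun p q' r => splitsum3 r (fun r1 r2 r3 =>
    (s p * s (p ++ u q' :: r1)) *: x (p ++ u q' :: r1 ++ u r2 :: r3) q))).
  congr (_ + _); rewrite [RHS]/splitsum3.
  under [RHS]eq_splitsum => p r _ do rewrite -splitsum3_left.
  rewrite -splitsum3_left; apply: eq_splitsum3 => a b c _.
  by apply: eq_splitsum => a1 a' <-; apply: eq_splitsum => a2 a3 <-.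
rewrite -splitsum3D; apply: splitsum30 => p q' r _.
rewrite -splitsum3D; apply: splitsum30 => r1 r2 r3 _.
(* Replacing [q'] by its image under [m] lowers the suspended degree by one, whence the opposite
   sign. *)
rewrite -scalerDl; suff -> : s (p ++ q' ++ r1) * s p = - (s p * s (p ++ u q' :: r1)).
  by rewrite addNr scale0r.
rewrite /s mulrC -mulrN; congr (_ * _); rewrite !sdegs_cat sdegs_cons tag_happ.
by apply: (sgn_odd (0)); ring.
Qed.

End Insertion.

Lemma ins_post (k : fieldType) (V W W' : gvect k) (m : gfam V V) et
    (t : glin W W' et) (x : gfam V W) : ins m (post t x) = post t (ins m x).
Proof.
apply: gfamP => v q; have tl : linear (t (q - et) q) by apply: linearP.
rewrite /ins /post (linear_splitsum3 tl); apply: eq_splitsum3 => a b c _.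
by rewrite (linear_scale tl).
Qed.

Section LinearFamily.
Variables (k : fieldType) (V W : gvect k) (t : glin V W 0).

Definition lin_fam : gfam V W := fun v q =>
  if v is [:: x] then t (tag x) q (tagged x) else 0.

Lemma hfam_lin : hfam (-1) lin_fam.
Proof.
split=> [|v q qN|//].
  move=> [|u [|u' v1]] [|w v2] i q a x y /=; rewrite ?scaler0 ?addr0 //.
  by rewrite linearP.
case: v qN => [|[i x] [|y v]] //= qN; apply: glin_deg.
by move: qN; rewrite /sdegs degs_cons degs_nil; apply: contraNneq => /= ->; lia.
Qed.

Lemma ins_lin (m : gfam V V) : hfam (-2) m -> ins m lin_fam = post t m.
Proof.
move=> hm; apply: gfamP => v q; rewrite /ins /splitsum3 splitsum_nill; last first.
  by move=> x a bc; apply: splitsum0 => b c _; case: a => [|y a]; rewrite scaler0.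
rewrite splitsum_nilr => [|b x c /=]; last by rewrite scaler0.
rewrite sdegs_nil scale1r (happ_at (q := sdegs v - 2)) //= /post.
have [->|qN] := eqVneq q (sdegs v - 2); first by rewrite subr0.
by rewrite glin_deg ?addr0 // (hfam_deg hm) ?linear0 // subr0.
Qed.

End LinearFamily.

(** * Composition with maps of tensor coalgebras *)

Section Composition.
Variables (k : fieldType) (U V : gvect k) (f : gfam U V).
Hypothesis hf : hfam (-1) f.

Section OneTarget.
Variable W : gvect k.

(* composition with the coalgebra map of tensor coalgebras induced by [f] *)
Definition comp (f : gfam U V) (x : gfam V W) : gfam U W := fun v q =>
  blocksum v (fun ws => x [seq happ (-1) f w | w <- ws] q).

Fact comp_is_linear : linear (comp f).
Proof.
move=> a x y; apply: gfamP => v q.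
by rewrite /comp !gfamE -blocksumZ -blocksumD.
Qed.

HB.instance Definition _ :=
  GRing.isLinear.Build k (gfam V W) (gfam U W) *:%R (comp f) comp_is_linear.

Lemma hfam_comp e x : hfam e x -> hfam e (comp f x).
Proof.
move=> hx; split=> [v1 v2 i q|v q qN|q].
- suff L : linear (fun z : U i => splitsum v1 (fun a1 a2 => splitsum v2 (fun c1 c2 =>
      blocksum a1 (fun w1 => blocksum c2 (fun w2 =>
        x (map (happ (-1) f) w1 ++ happ (-1) f (a2 ++ Tagged U z :: c1) ::
           map (happ (-1) f) w2) q))))).
    have E (z : U i) : comp f x (v1 ++ Tagged U z :: v2) q =
      splitsum v1 (fun a1 a2 => splitsum v2 (fun c1 c2 =>
        blocksum a1 (fun w1 => blocksum c2 (fun w2 =>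
          x (map (happ (-1) f) w1 ++ happ (-1) f (a2 ++ Tagged U z :: c1) ::
             map (happ (-1) f) w2) q)))).
      rewrite /comp blocksum_cat; apply: eq_splitsum => a1 a2 _.
      apply: eq_splitsum => c1 c2 _; apply: eq_blocksum => w1 _ _.
      by apply: eq_blocksum => w2 _ _; rewrite map_cat.
    by move=> a y z; rewrite !E; apply: L.
  apply: splitsum_linear => a1 a2; apply: splitsum_linear => c1 c2.
  apply: blocksum_linear => w1; apply: blocksum_linear => w2.
  apply: (happ_linear (G := fun u => x (_ ++ u :: _) q) a2 c1 (i := i) hf).
  by move=> j; apply: (hfam_ml hx).
- apply: blocksum0 => ws wsv _; apply: (hfam_deg hx).
  by rewrite sdegs_map_happ wsv.
- exact: (hfam_nil hx).
Qed.

Lemma happ_comp e (x : gfam V W) v :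
  happ e (comp f x) v = Tagged W (blocksum v (fun ws =>
    x [seq happ (-1) f w | w <- ws] (sdegs v + e))).
Proof. exact: happ_at. Qed.

Lemma comp_first (x : gfam V W) v q :
  comp f x v q = (if v is [::] then x [::] q else 0) +
    splitsum v (fun a b => if a is [::] then 0 else
      comp f (fun w => x (happ (-1) f a :: w)) b q).
Proof. exact: blocksum_first. Qed.

End OneTarget.

Lemma comp_lin (W : gvect k) (t : glin V W 0) : comp f (lin_fam t) = post t f.
Proof.
apply: gfamP => v q; rewrite comp_first.
case: v => [|x v]; first by rewrite /= add0r /post (hfam_nil hf) linear0.
rewrite add0r splitsum_nilr => [|[|y a] z b //]; last first.
  by apply: blocksum0 => -[|w ws] //.
set w := x :: v; rewrite -[LHS]/(lin_fam t [:: happ (-1) f w] q).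
rewrite (happ_at (q := sdegs w - 1)) //= /post.
have [->|qN] := eqVneq q (sdegs w - 1); first by rewrite subr0.
by rewrite glin_deg ?addr0 // (hfam_deg hf) ?linear0 // subr0.
Qed.

Lemma comp_post (W W' : gvect k) et (t : glin W W' et) (x : gfam V W) :
  comp f (post t x) = post t (comp f x).
Proof.
apply: gfamP => v q; have tl : linear (t (q - et) q) by apply: linearP.
by rewrite /comp /post (linear_blocksum tl).
Qed.

End Composition.

(** The induction peels off the first block of [f]. Fixing the first argument of [x] gives a family
    that need neither vanish on the empty word nor have the same degree, so only multilinearity is
    carried along. *)
Lemma comp_comp_ml (k : fieldType) (T U V W : gvect k) (g : gfam T U) (f : gfam U V)
    (n : nat) (x : gfam V W) v q : (size v <= n)%N ->
  (forall v1 v2 i q, linear (fun z : V i => x (v1 ++ Tagged V z :: v2) q)) ->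
  comp g (comp f x) v q = comp (comp g f) x v q.
Proof.
elim: n x v q => [|n IHn] x v q vn xl; first by case: v vn.
rewrite [RHS]comp_first.
pose F (wa : seq (seq (homog T))) : gfam V W := fun w =>
  x (happ (-1) f (map (happ (-1) g) wa) :: w).
(* [wa] is the nonempty group of blocks of [g] that feeds the first block of [f]. *)
transitivity ((if v is [::] then x [::] q else 0) +
  splitsum v (fun a b => blocksum a (fun wa => if wa is [::] then 0 else
    comp g (comp f (F wa)) b q))).
  rewrite {1}/comp.
  transitivity (blocksum v (fun ws => (if ws is [::] then x [::] q else 0) +
    splitsum ws (fun wa wb => if wa is [::] then 0 else
      comp f (F wa) (map (happ (-1) g) wb) q))).
    apply: eq_blocksum => ws _ _; rewrite comp_first splitsum_map.
    congr (_ + _); first by case: ws.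
    by apply: eq_splitsum => -[|w wa] wb _.
  rewrite blocksumD blocksum_splitsum; congr (_ + _).
    case: v vn => [|y v] // _; apply: blocksum0 => -[|w ws] //.
  apply: eq_splitsum => a b _; apply: eq_blocksum => -[|w wa] _ _ //.
  exact: blocksum0.
congr (_ + _); apply: eq_splitsum => -[|y a] b abv //.
set w := y :: a.
have xfl i w' q' : linear (fun z : V i => x (Tagged V z :: w') q') by apply: (xl [::]).
transitivity (blocksum w (fun wa => comp (comp g f) (F wa) b q)).
  apply: eq_blocksum => -[|w1 wa] //= _ _; apply: IHn.
    by move: vn; rewrite -abv /= size_cat; lia.
  by move=> v1 v2 i q'; apply: (xl (_ :: v1)).
rewrite {1}/comp blocksum_exchange /comp; apply: eq_blocksum => wb _ _.
rewrite happ_comp (linear_blocksum (xfl _ _ _)); apply: eq_blocksum => wa wE _.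
by rewrite /F (happ_at (q := sdegs w + -1)) // sdegs_map_happ wE.
Qed.

Lemma comp_comp (k : fieldType) (T U V W : gvect k) (g : gfam T U) (f : gfam U V)
    e (x : gfam V W) : hfam e x -> comp g (comp f x) = comp (comp g f) x.
Proof.
move=> hx; apply: gfamP => v q; apply: comp_comp_ml (leqnn _) _.
by move=> v1 v2 i q'; apply: (hfam_ml hx).
Qed.

(** A coalgebra map that intertwines two coderivations after projection to the cogenerators
    intertwines them. The hypothesis applies to the group of blocks fed to [m']; the blocks on
    either side of it are carried along unchanged. *)
Lemma comp_ins (k : fieldType) (U V W : gvect k) (m : gfam U U) (m' : gfam V V)
    (f : gfam U V) e (x : gfam V W) : hfam e x ->
  ins m f = comp f m' -> comp f (ins m' x) = ins m (comp f x).
Proof.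
move=> hx fm; apply: gfamP => v q; rewrite /comp /ins.
pose s (V' : gvect k) (a : seq (homog V')) : k := sgn k (sdegs a).
pose F ws := map (happ (-1) f) ws.
transitivity (splitsum3 v (fun a b c => blocksum a (fun wa => blocksum c (fun wc =>
   splitsum3 b (fun b1 b2 b3 => (s _ a * s _ b1) *:
      x (F wa ++ happ (-1) f (b1 ++ happ (-2) m b2 :: b3) :: F wc) q))))).
  under [LHS]eq_blocksum => ws _ _ do rewrite splitsum3_map.
  rewrite blocksum_splitsum3; apply: eq_splitsum3 => a b c _.
  apply: eq_blocksum => wa waE _; rewrite blocksum_exchange.
  apply: eq_blocksum => wc _ _.
  have xl : linear (fun z => x (F wa ++ Tagged V z :: F wc) q) :=
    hfam_ml hx (F wa) (F wc) (i := sdegs b - 2) q.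
  transitivity (s _ a *: x (F wa ++ Tagged V (comp f m' b (sdegs b - 2)) :: F wc) q).
    rewrite /comp (linear_blocksum xl) -blocksumZ; apply: eq_blocksum => wb wbE _.
    rewrite /s -waE -(sdegs_map_happ f); congr (_ *: x (_ ++ _ :: _) _).
    by apply: happ_at; rewrite sdegs_map_happ wbE.
  rewrite -fm /ins (linear_splitsum3 xl) -splitsum3Z.
  apply: eq_splitsum3 => b1 b2 b3 bE; rewrite (linear_scale xl) scalerA.
  congr (_ *: x (_ ++ _ :: _) _); apply/esym/happ_at.
  by rewrite -bE !sdegs_cat sdegs_cons tag_happ; lia.
transitivity (splitsum3 v (fun a b c => splitsum3 b (fun b1 b2 b3 =>
   blocksum a (fun wa => blocksum c (fun wc => (s _ a * s _ b1) *:
      x (F wa ++ happ (-1) f (b1 ++ happ (-2) m b2 :: b3) :: F wc) q))))).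
  apply: eq_splitsum3 => a b c _; rewrite splitsum3_blocksum.
  by apply: eq_blocksum => wa _ _; rewrite splitsum3_blocksum.
rewrite -(splitsum3_mid v (fun a1 a2 b c1 c2 =>
   blocksum a1 (fun wa => blocksum c2 (fun wc => (s _ a1 * s _ a2) *:
      x (F wa ++ happ (-1) f (a2 ++ happ (-2) m b :: c1) :: F wc) q)))).
apply: eq_splitsum3 => a b c _; rewrite blocksum_cat -splitsumZ.
apply: eq_splitsum => a1 a2 <-; rewrite -splitsumZ.
apply: eq_splitsum => c1 c2 _; rewrite -blocksumZ.
apply: eq_blocksum => wa _ _; rewrite -blocksumZ; apply: eq_blocksum => wc _ _.
by rewrite /F map_cat /= /s sdegs_cat sgnD.
Qed.

(** * The convolution algebra *)

Section Convolution.
Variables (k : fieldType) (A : gvect k) (D : dgAlg A).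
Implicit Types (u w : homog A).

Definition dgm u w : forall q, A q := fun q => dg_mul D q (tagged u) (tagged w).

Lemma dgm_linl w q i : linear (fun x : A i => dgm (Tagged A x) w q).
Proof. by move=> a x y; apply: dg_mul_linl. Qed.

Lemma dgm_linr u q i : linear (fun x : A i => dgm u (Tagged A x) q).
Proof. by move=> a x y; apply: dg_mul_linr. Qed.

Arguments dgm_linl w q {i}.
Arguments dgm_linr u q {i}.

Lemma dgm_deg u w q : q != tag u + tag w -> dgm u w q = 0.
Proof. exact: dg_mul_deg. Qed.

(** The intermediate degrees are variables tied by equations, so that the rule applies without
    transporting vectors between degrees. *)
Lemma dgmA u v w q r s : r = tag u + tag v -> s = tag v + tag w ->
  dgm (Tagged A (dgm u v r)) w q = dgm u (Tagged A (dgm v w s)) q.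
Proof.
move=> -> ->; have [->|qN] := eqVneq q (tag u + tag v + tag w).
  exact: dg_mulA.
by rewrite [LHS]dgm_deg //= [RHS]dgm_deg //= addrA.
Qed.

Definition hd u : homog A :=
  Tagged A (dg_d D (tag u) (tag u + -1) (tagged u)).

Lemma dgm_leibniz u w q :
  dg_d D (q - -1) q (dgm u w (q - -1)) =
  dgm (hd u) w q + sgn k (tag u) *: dgm u (hd w) q.
Proof.
have [->|qN] := eqVneq q (tag u + tag w - 1).
  rewrite (_ : _ - -1 = tag u + tag w); last by lia.
  rewrite /dgm dg_leibniz (sgn_mod2 (- tag u) (z' := tag u)) //; ring.
rewrite !dgm_deg ?linear0 ?scaler0 ?addr0 //=.
- by apply: contraNneq qN; lia.
- by apply: contraNneq qN; lia.
- by apply: contraNneq qN; lia.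
Qed.

Section OneSource.
Variable V : gvect k.
Implicit Types x y z : gfam V A.

(* convolution product of families of degrees [e1] and [e2] *)
Definition cprod (e1 e2 : int) x y : gfam V A := fun v q =>
  splitsum v (fun a b =>
    sgn k (e2 * sdegs a) *: dgm (happ e1 x a) (happ e2 y b) q).

Lemma cprod_is_linear e1 e2 x : linear (cprod e1 e2 x).
Proof.
move=> a y z; apply: gfamP => v q; rewrite /cprod !gfamE -splitsumZ -splitsumD.
apply: eq_splitsum => b c _.
rewrite !(happ_at (e := e2) (v := c) (q := sdegs c + e2)) // !gfamE dgm_linr.
by rewrite scalerDr !scalerA mulrC.
Qed.

Lemma cprod_linearl e1 e2 y : linear (fun x => cprod e1 e2 x y).
Proof.
move=> a x z; apply: gfamP => v q; rewrite /cprod !gfamE -splitsumZ -splitsumD.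
apply: eq_splitsum => b c _.
rewrite !(happ_at (e := e1) (v := b) (q := sdegs b + e1)) // !gfamE dgm_linl.
by rewrite scalerDr !scalerA mulrC.
Qed.

HB.instance Definition _ e1 e2 x := GRing.isLinear.Build k (gfam V A) (gfam V A)
  *:%R (cprod e1 e2 x) (cprod_is_linear e1 e2 x).

Lemma cprodDl e1 e2 x y z :
  cprod e1 e2 (x + y) z = cprod e1 e2 x z + cprod e1 e2 y z.
Proof. exact: (linear_add (cprod_linearl e1 e2 z)). Qed.

Lemma cprodZl e1 e2 c x z : cprod e1 e2 (c *: x) z = c *: cprod e1 e2 x z.
Proof. exact: (linear_scale (cprod_linearl e1 e2 z)). Qed.

Lemma cprodNl e1 e2 x z : cprod e1 e2 (- x) z = - cprod e1 e2 x z.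
Proof. by rewrite -!scaleN1r cprodZl. Qed.

Lemma cprodBl e1 e2 x y z :
  cprod e1 e2 (x - y) z = cprod e1 e2 x z - cprod e1 e2 y z.
Proof. by rewrite cprodDl cprodNl. Qed.

Lemma cprod0l e1 e2 z : cprod e1 e2 0 z = 0.
Proof. exact: (linear_zero (cprod_linearl e1 e2 z)). Qed.

Lemma hfam_cprod e1 e2 x y : hfam e1 x -> hfam e2 y -> hfam (e1 + e2) (cprod e1 e2 x y).
Proof.
move=> hx hy; split=> [v1 v2 i q|v q qN|q].
- have E (z : V i) : cprod e1 e2 x y (v1 ++ Tagged V z :: v2) q =
    splitsum v1 (fun a1 a2 => sgn k (e2 * sdegs a1) *:
      dgm (happ e1 x a1) (happ e2 y (a2 ++ Tagged V z :: v2)) q) +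
    splitsum v2 (fun c1 c2 => sgn k (e2 * (sdegs v1 + (i + 1 + sdegs c1))) *:
      dgm (happ e1 x (v1 ++ Tagged V z :: c1)) (happ e2 y c2) q).
    rewrite /cprod splitsum_cat; congr (_ + _); apply: eq_splitsum => c1 c2 _.
    by rewrite sdegs_cat sdegs_cons.
  suff L : linear (fun z : V i =>
    splitsum v1 (fun a1 a2 => sgn k (e2 * sdegs a1) *:
      dgm (happ e1 x a1) (happ e2 y (a2 ++ Tagged V z :: v2)) q) +
    splitsum v2 (fun c1 c2 => sgn k (e2 * (sdegs v1 + (i + 1 + sdegs c1))) *:
      dgm (happ e1 x (v1 ++ Tagged V z :: c1)) (happ e2 y c2) q)).
    by move=> a z z'; rewrite !E; apply: L.
  apply: add_linear; apply: splitsum_linear => a b; apply: scale_linear.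
    by apply: (happ_linear (G := fun u => dgm _ u q) b v2 hy) => j; apply: dgm_linr.
  by apply: (happ_linear (G := fun u => dgm u _ q) v1 a hx) => j; apply: dgm_linl.
- apply: splitsum0 => a b abv; rewrite dgm_deg ?scaler0 // !tag_happ.
  by move: qN; rewrite -abv sdegs_cat; apply: contraNneq; lia.
- by rewrite /cprod /= (happ_nil hx) (linear_zero (dgm_linl _ _)) scaler0.
Qed.

Lemma cprodA e1 e2 e3 x y z :
  cprod (e1 + e2) e3 (cprod e1 e2 x y) z = cprod e1 (e2 + e3) x (cprod e2 e3 y z).
Proof.
apply: gfamP => v q; rewrite {1}/cprod [RHS]/cprod.
pose G a b c := sgn k (e3 * (sdegs a + sdegs b) + e2 * sdegs a) *:
  dgm (happ e1 x a) (Tagged A (dgm (happ e2 y b) (happ e3 z c)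
    (sdegs b + e2 + (sdegs c + e3)))) q.
transitivity (splitsum3 v G).
  rewrite -splitsumA; apply: eq_splitsum => ab c _.
  rewrite (happ_at (f := cprod e1 e2 x y) (q := sdegs ab + (e1 + e2))) // /cprod.
  rewrite (linear_splitsum (dgm_linl _ _)) -splitsumZ.
  apply: eq_splitsum => a b abE.
  rewrite (linear_scale (dgm_linl _ _)) scalerA -sgnD /G -abE sdegs_cat.
  by congr (_ *: _); apply: dgmA; rewrite !tag_happ //; lia.
apply: eq_splitsum => a bc _.
rewrite (happ_at (f := cprod e2 e3 y z) (q := sdegs bc + (e2 + e3))) // /cprod.
rewrite (linear_splitsum (dgm_linr _ _)) -splitsumZ.
apply: eq_splitsum => b c bcE.
rewrite (linear_scale (dgm_linr _ _)) scalerA -sgnD /G -bcE sdegs_cat.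
congr (sgn k _ *: dgm _ _ _); first by ring.
by apply: tagged_at; lia.
Qed.

(** The inserted block lies in the right or in the left factor, so a coderivation acts as a
    derivation of the convolution product. *)
Lemma ins_cprod (m : gfam V V) e1 e2 x y :
  ins m (cprod e1 e2 x y) =
  cprod e1 (e2 - 1) x (ins m y) + sgn k e2 *: cprod (e1 - 1) e2 (ins m x) y.
Proof.
apply: gfamP => v q; rewrite !gfamE.
pose ub b := happ (-2) m b; pose s a : k := sgn k (sdegs (V := V) a).
transitivity (splitsum3 v (fun a b c => splitsum a (fun a1 a2 =>
    (s (a1 ++ a2) * sgn k (e2 * sdegs a1)) *:
      dgm (happ e1 x a1) (happ e2 y (a2 ++ ub b :: c)) q)) +
  splitsum3 v (fun a b c => splitsum c (fun c1 c2 =>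
    (s a * sgn k (e2 * (sdegs a + (sdegs b - 1 + sdegs c1)))) *:
      dgm (happ e1 x (a ++ ub b :: c1)) (happ e2 y c2) q))).
  rewrite -splitsum3D; apply: eq_splitsum3 => a b c _.
  rewrite /cprod splitsum_cat scalerDr -!splitsumZ; congr (_ + _).
    by apply: eq_splitsum => a1 a2 <-; rewrite scalerA.
  apply: eq_splitsum => c1 c2 _; rewrite scalerA sdegs_cat sdegs_cons tag_happ.
  by congr ((_ * sgn k (_ * (_ + (_ + _)))) *: _); lia.
congr (_ + _).
  rewrite (splitsum3_left v (fun a1 a2 b c => (s (a1 ++ a2) * sgn k (e2 * sdegs a1)) *:
      dgm (happ e1 x a1) (happ e2 y (a2 ++ ub b :: c)) q)).
  apply: eq_splitsum => a1 r _.
  rewrite (happ_at (f := ins m y) (q := sdegs r + (e2 - 1))) // /ins.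
  rewrite (linear_splitsum3 (dgm_linr _ _)) -splitsum3Z.
  apply: eq_splitsum3 => a2 b c abc.
  rewrite (linear_scale (dgm_linr _ _)) scalerA /s -!sgnD sdegs_cat.
  congr (_ *: dgm _ _ _); first by apply: (sgn_mod2 (sdegs a1)); ring.
  by apply: happ_at; rewrite -abc !sdegs_cat sdegs_cons tag_happ; lia.
rewrite (splitsum3_right v (fun a b c1 c2 =>
    (s a * sgn k (e2 * (sdegs a + (sdegs b - 1 + sdegs c1)))) *:
      dgm (happ e1 x (a ++ ub b :: c1)) (happ e2 y c2) q)).
rewrite -splitsumZ; apply: eq_splitsum => r c2 _.
rewrite (happ_at (f := ins m x) (q := sdegs r + (e1 - 1))) // /ins.
rewrite (linear_splitsum3 (dgm_linl _ _)) scalerA -splitsum3Z.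
apply: eq_splitsum3 => a b c abc.
rewrite (linear_scale (dgm_linl _ _)) scalerA /s -!sgnD -abc !sdegs_cat.
congr (_ *: dgm _ _ _); first by apply: (sgn_mod2 (- e2)); ring.
by apply: happ_at; rewrite !sdegs_cat sdegs_cons tag_happ; lia.
Qed.

Lemma post_cprod e1 e2 x y :
  post (dg_d D) (cprod e1 e2 x y) =
  cprod (e1 - 1) e2 (post (dg_d D) x) y +
  sgn k e1 *: cprod e1 (e2 - 1) x (post (dg_d D) y).
Proof.
apply: gfamP => v q; rewrite !gfamE /cprod.
have dl : linear (dg_d D (q - -1) q) by apply: linearP.
rewrite {1}/post (linear_splitsum dl) -splitsumZ -splitsumD.
apply: eq_splitsum => a b _.
rewrite (linear_scale dl) dgm_leibniz !happ_post scalerDr -/(hd _) -/(hd _).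
congr (_ + _); rewrite !scalerA -!sgnD tag_happ; congr (_ *: _).
by apply: (sgn_mod2 (sdegs a)); ring.
Qed.

(* Since the factors of a convolution product vanish on the empty list, they are
   only evaluated on shorter lists. *)
Lemma eq_cprod e1 e2 x x' y y' v q :
  (forall q', x [::] q' = 0) -> (forall q', x' [::] q' = 0) ->
  (forall q', y [::] q' = 0) -> (forall q', y' [::] q' = 0) ->
  (forall (w : seq (homog V)) q', (size w < size v)%N -> x w q' = x' w q') ->
  (forall (w : seq (homog V)) q', (size w < size v)%N -> y w q' = y' w q') ->
  cprod e1 e2 x y v q = cprod e1 e2 x' y' v q.
Proof.
move=> hx hx' hy hy' xx' yy'; apply: eq_splitsum => a b abv; congr (_ *: _).
have [a0|a0] := eqVneq a [::].
  by rewrite a0 /happ hx hx' !(linear_zero (dgm_linl _ _)).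
have [b0|b0] := eqVneq b [::].
  by rewrite b0 /happ hy hy' !(linear_zero (dgm_linr _ _)).
have sa : (size a < size v)%N.
  by rewrite -abv size_cat -[X in (X < _)%N]addn0 ltn_add2l; case: b b0 {abv}.
have sb : (size b < size v)%N.
  by rewrite -abv size_cat -[X in (X < _)%N]add0n ltn_add2r; case: a a0 {abv sa}.
by rewrite /happ /dgm /= xx' // yy'.
Qed.

Lemma cprod_vanishl e1 e2 x y v q : hfam e1 x -> hfam e2 y ->
  (forall (w : seq (homog V)) q', (size w < size v)%N -> x w q' = 0) ->
  cprod e1 e2 x y v q = 0.
Proof.
move=> hx hy x0.
by rewrite (@eq_cprod e1 e2 x 0 y y) ?cprod0l //; apply: hfam_nil; eassumption.
Qed.

Lemma cprod_vanishr e1 e2 x y v q : hfam e1 x -> hfam e2 y ->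
  (forall (w : seq (homog V)) q', (size w < size v)%N -> y w q' = 0) ->
  cprod e1 e2 x y v q = 0.
Proof.
move=> hx hy y0.
rewrite (@eq_cprod e1 e2 x x y 0) ?(linear0 (cprod e1 e2 x)) //;
  by apply: hfam_nil; eassumption.
Qed.

End OneSource.

(** Precomposition with a coalgebra map is multiplicative, by [blocksum_splitsum]. *)
Lemma comp_cprod (U V : gvect k) (f : gfam U V) e1 e2 (x y : gfam V A) :
  comp f (cprod e1 e2 x y) = cprod e1 e2 (comp f x) (comp f y).
Proof.
apply: gfamP => v q; rewrite [LHS]/comp /cprod.
under [LHS]eq_blocksum => ws _ _ do rewrite splitsum_map.
rewrite blocksum_splitsum; apply: eq_splitsum => a b _.
rewrite !happ_comp.
rewrite (linear_blocksum (dgm_linl _ _)) -blocksumZ.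
apply: eq_blocksum => wa waE _.
rewrite (linear_blocksum (dgm_linr _ _)) -blocksumZ.
apply: eq_blocksum => wb wbE _; rewrite sdegs_map_happ waE.
by congr (_ *: dgm _ _ _); apply: happ_at; rewrite sdegs_map_happ ?waE ?wbE.
Qed.

End Convolution.

Arguments dgm_linl {k A} D w q {i}.
Arguments dgm_linr {k A} D u q {i}.

(** * Block decompositions as compositions of integers *)

Section Compositions.

Definition incr_head (sh : seq nat) := if sh is s :: sh' then s.+1 :: sh' else [::].

(** Same recursion as [blocksum]: the first letter is a block of its own or joins the next block. *)
Fixpoint compositions (n : nat) : seq (seq nat) :=
  if n is n'.+1 then
    [seq 1%N :: sh | sh <- compositions n'] ++
    [seq incr_head sh | sh <- compositions n' & sh != [::]]
  else [:: [::]].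

Lemma mem_compositions n sh :
  (sh \in compositions n) = all (fun a => 0 < a)%N sh && (sumn sh == n).
Proof.
elim: n sh => [|n IHn] sh.
  by case: sh => [|[|s] sh] //=; rewrite inE addSn /= andbF.
rewrite /= mem_cat; apply/orP/andP => [[]|[]].
- by case/mapP => sh'; rewrite IHn => /andP[sh0 /eqP <-] ->.
- case/mapP => sh'; rewrite mem_filter IHn => /and3P[shN sh0 /eqP shE] ->.
  by case: sh' shN sh0 shE => [|s sh'] //= _ /andP[s0 ->] <-.
case: sh => [|[|[|s]] sh] //= sh0; rewrite addSn eqSS => shE; [left|right].
  by apply/mapP; exists sh; rewrite // IHn sh0.
by apply/mapP; exists (s.+1 :: sh); rewrite // mem_filter IHn /= sh0.
Qed.

Lemma uniq_compositions n : uniq (compositions n).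
Proof.
elim: n => [|n IHn] //=; rewrite cat_uniq; apply/and3P; split.
- by rewrite map_inj_uniq // => s s' [].
- apply/hasPn => sh /mapP[[|[|s] sh']]; rewrite mem_filter ?mem_compositions //=.
  by move=> _ ->; apply/mapP => -[].
- rewrite map_inj_uniq ?filter_uniq //.
  by move=> [|s sh] [|s' sh'] //= [-> ->].
Qed.

Lemma blocksum_compositions (T : Type) (U : nmodType) (v : seq T)
    (F : seq (seq T) -> U) :
  blocksum v F = \sum_(sh <- compositions (size v)) F (reshape sh v).
Proof.
elim: v F => [|x v IHv] F /=; first by rewrite big_seq1.
rewrite IHv big_split big_cat big_map /= big_map big_filter; congr (_ + _).
  by apply: eq_bigr => sh _; rewrite drop0 take0.
rewrite [RHS]big_mkcond; apply: eq_bigr => -[|s sh] _ //.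
Qed.

(** A composition of a positive n has between 1 and n parts, each at most n, so the tuples indexing
    [gcomp] list each composition once. For n = 0 the empty composition would be missed. *)
Lemma sum_tuple_compositions (U : nmodType) (n : nat) (F : seq nat -> U) :
  (0 < n)%N ->
  \sum_(1 <= r < n.+1) \sum_(i : r.-tuple 'I_n.+1 |
     all (fun a : 'I__ => 0 < a)%N i && (\sum_(a <- i) a == n)%N)
    F [seq nat_of_ord a | a <- i] =
  \sum_(sh <- compositions n) F sh.
Proof.
move=> n0.
transitivity (\sum_(1 <= r < n.+1) \sum_(sh <- compositions n | size sh == r) F sh).
  apply: eq_bigr => r _; rewrite -big_filter -[RHS]big_filter.
  rewrite -(big_map (fun i : r.-tuple 'I_n.+1 => [seq nat_of_ord a | a <- i]) xpredT F).
  apply: perm_big; apply: uniq_perm.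
  - rewrite map_inj_uniq ?filter_uniq ?index_enum_uniq // => i j /inj_map ij.
    by apply/val_inj/ij/val_inj.
  - by rewrite filter_uniq // uniq_compositions.
  move=> sh; rewrite mem_filter mem_compositions; apply/mapP/and3P.
    case=> i; rewrite mem_filter mem_index_enum => /andP[/andP[i0 /eqP iE] _] ->.
    by rewrite size_map size_tuple all_map sumnE big_map iE.
  case=> /eqP shr sh0 /eqP shn.
  have shle : all (fun a => a < n.+1)%N sh.
    apply/allP => a ash; rewrite ltnS -shn; move: ash; clear.
    elim: sh => //= b sh IHsh; rewrite inE => /orP[/eqP ->|/IHsh]; lia.
  have iP : size [seq (inord a : 'I_n.+1) | a <- sh] == r by rewrite size_map shr.
  have iE : [seq nat_of_ord a | a <- [seq (inord a : 'I_n.+1) | a <- sh]] = sh.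
    rewrite -map_comp -[RHS]map_id; apply/eq_in_map => a ash /=.
    by rewrite inordK // (allP shle).
  exists (Tuple iP); last by rewrite /= iE.
  rewrite mem_filter mem_index_enum andbT; apply/andP; split.
    by move: sh0; rewrite -{1}iE all_map.
  by rewrite -(big_map (@nat_of_ord n.+1) xpredT id) -sumnE /= iE shn.
under eq_bigr do rewrite big_mkcond.
rewrite exchange_big big_seq [RHS]big_seq; apply: eq_bigr => sh.
rewrite mem_compositions => /andP[sh0 /eqP shn].
rewrite -big_mkcond (eq_bigl (fun r => r == size sh)); last by move=> r; rewrite eq_sym.
rewrite big_nat1_eq; case: ifP => // /negP[]; apply/andP; split.
  by case: sh sh0 shn n0 => // _ /= <-.
rewrite ltnS -shn; elim: sh sh0 {shn} => //= a sh IHsh /andP[a0 /IHsh]; lia.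
Qed.

End Compositions.

Local Arguments happ : simpl never.

(** * Desuspension of signs *)

Section Desuspension.
Variable k : fieldType.

(* exponent of the Koszul sign of the n-th tensor power of the desuspension *)
Fixpoint hsign (V : gvect k) (v : seq (homog V)) : int :=
  if v is x :: v' then (size v')%:Z * (tag x + 1) + hsign v' else 0.

Lemma hsign_cons (V : gvect k) x (v : seq (homog V)) :
  hsign (x :: v) = (size v)%:Z * (tag x + 1) + hsign v.
Proof. by []. Qed.

Lemma hsign_cat (V : gvect k) (v w : seq (homog V)) :
  hsign (v ++ w) = hsign v + hsign w + (size w)%:Z * sdegs v.
Proof.
elim: v => [|x v IHv] /=; first by rewrite sdegs_nil; ring.
by rewrite IHv sdegs_cons size_cat PoszD; ring.
Qed.

Lemma eq_hsign (V : gvect k) (v w : seq (homog V)) :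
  map tag v = map tag w -> hsign v = hsign w.
Proof.
elim: v w => [|x v IHv] [|y w] //= [xy vw].
by rewrite xy (IHv _ vw) -(size_map tag v) vw size_map.
Qed.

(* The sign-twisted family vanishes on the empty list, where the values of the
   original one are irrelevant. *)
Definition hat (V W : gvect k) (f : gfam V W) : gfam V W := fun v q =>
  if v is [::] then 0 else sgn k (hsign v) *: f v q.

Section OneFamily.
Variables V W : gvect k.
Implicit Types f g : gfam V W.

Lemma hatE f v q : v != [::] -> hat f v q = sgn k (hsign v) *: f v q.
Proof. by case: v. Qed.

Lemma hatK f : (forall q, f [::] q = 0) -> hat (hat f) = f.
Proof.
move=> f0; apply: gfamP => -[|x v] q; first by rewrite f0.
by rewrite !hatE // scalerA sgn_sqr scale1r.
Qed.

Lemma hat_inj f g : hat f = hat g -> gfam_eq f g.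
Proof.
move=> fg v q v0; have := congr1 (fun h => h v q) fg; rewrite !hatE //.
move/(congr1 (fun y => sgn k (hsign v) *: y)).
by rewrite !scalerA sgn_sqr !scale1r.
Qed.

Lemma eq_hat f g : gfam_eq f g -> hat f = hat g.
Proof. by move=> fg; apply: gfamP => -[|x v] q //; rewrite !hatE // fg. Qed.

Lemma multilinear_linear f v1 v2 i q : multilinear f ->
  linear (fun x : V i => f (v1 ++ Tagged V x :: v2) q).
Proof. by move=> fl a x y; apply: fl. Qed.

Lemma hat_linear f v1 v2 i q : multilinear f ->
  linear (fun x : V i => hat f (v1 ++ Tagged V x :: v2) q).
Proof.
move=> fl; pose c := hsign (v1 ++ Tagged V (0 : V i) :: v2).
have E (x : V i) : hat f (v1 ++ Tagged V x :: v2) q =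
    sgn k c *: f (v1 ++ Tagged V x :: v2) q.
  rewrite hatE; last by case: v1 {c}.
  by congr (sgn k _ *: _); apply: eq_hsign; rewrite !map_cat.
move=> a x y; rewrite !E.
exact: (scale_linear _ (multilinear_linear v1 v2 (i := i) q fl)).
Qed.

Lemma hfam_hat e f : is_gfam e f -> hfam e (hat f).
Proof.
move=> [fl fd]; split=> // [v1 v2 i q|v q qN]; first exact: hat_linear.
case: v qN => [|x v] // qN; rewrite hatE // fd ?scaler0 //.
by rewrite addrA.
Qed.

Lemma is_gfam_hat e f : hfam e f -> is_gfam e (hat f).
Proof.
move=> hf; split.
  move=> v1 v2 i a x y q; apply: (hat_linear v1 v2 (i := i) q).
  by move=> w1 w2 j b z z' q'; apply: (hfam_ml hf).
move=> v q v0 qN; rewrite hatE // (hfam_deg hf) ?scaler0 //.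
by rewrite -addrA.
Qed.

End OneFamily.

Lemma happ_hat (V W : gvect k) e (f : gfam V W) v : v != [::] ->
  happ e (hat f) v = Tagged W (sgn k (hsign v) *: f v (sdegs v + e)).
Proof. by move=> v0; rewrite (happ_at (q := sdegs v + e)) // hatE. Qed.

(** Modulo 2, the exponent rs + t, the Koszul sign and the twists of both families leave only the
    suspended degree of [a]: on the suspension every m_s is odd, whatever its arity. *)
Lemma hat_insertion_term (V W : gvect k) (f : gfam V W) (m : gfam V V) a b c q :
  multilinear f -> b != [::] ->
  sgn k (sdegs a) *: hat f (a ++ happ (-2) (hat m) b :: c) q =
  sgn k (hsign (a ++ b ++ c)) *:
    ((sgn k (size a * size b + size c)%N * sgn k (((size b)%:Z - 2) * degs a)) *:
     f (a ++ happ (-2) m b :: c) q).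
Proof.
move=> fl b0; rewrite happ_hat // (linear_scale (hat_linear _ _ _ fl)).
rewrite -[Tagged V (m b _)](happ_at (e := -2)) // hatE; last by case: a.
rewrite !scalerA -!sgnD; congr (_ *: _).
apply: (sgn_mod2 (2 * degs a + (size a)%:Z - (size c)%:Z
  - (size b)%:Z * degs a - (size b)%:Z * (size a)%:Z)).
rewrite !hsign_cat hsign_cons tag_happ size_cat !PoszD PoszM /= /sdegs.
ring.
Qed.

Lemma hat_insertion (V W : gvect k) (f : gfam V W) (m : gfam V V) :
  multilinear f -> hat (insertion f m) = ins (hat m) (hat f).
Proof.
move=> fl; have hl := hat_linear _ _ _ fl.
have hat0 v1 v2 q : hat f (v1 ++ happ (-2) (hat m) [::] :: v2) q = 0.
  exact: (linear_zero (hl v1 v2 _ q)).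
apply: gfamP => w q; have [->|w0] := eqVneq w [::].
  transitivity (sgn k (sdegs ([::] : seq (homog V))) *:
    hat f ([::] ++ happ (-2) (hat m) [::] :: [::]) q) => //.
  by rewrite hat0 scaler0.
rewrite hatE // /insertion scaler_sumr.
(* [ins] also runs over empty middle blocks, which [insertion] omits; they contribute 0 because
   [hat m] vanishes on the empty word. *)
rewrite /ins /splitsum3 splitsumE [RHS]big_nat_recr //=.
rewrite [X in _ = _ + X]splitsum0; last first.
  move=> b c; rewrite drop_size; case: b => [|? ?] //= _.
  by rewrite hat0 scaler0.
rewrite addr0 [LHS]big_nat [RHS]big_nat; apply: eq_bigr => r /= rw.
rewrite splitsumE [RHS]big_nat_recl //= take0 hat0 scaler0 add0r size_drop.
rewrite big_add1 /= scaler_sumr [LHS]big_nat [RHS]big_nat.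
apply: eq_bigr => s /= sw.
have sb : size (take s.+1 (drop r w)) = s.+1.
  by rewrite size_takel // size_drop.
rewrite hat_insertion_term //; last by rewrite -size_eq0 sb.
rewrite !cat_take_drop sb size_takel; last exact: ltnW.
by rewrite !size_drop drop_drop [(s.+1 + r)%N]addnC.
Qed.

Lemma ord_sumsS (n : nat) (F : nat -> nat -> int) :
  \sum_(l < n.+1) \sum_(j < l) F l j =
  \sum_(l < n) F l.+1 0%N + \sum_(l < n) \sum_(j < l) F l.+1 j.+1.
Proof.
rewrite big_ord_recl big_ord0 add0r -big_split; apply: eq_bigr => l _ /=.
by rewrite big_ord_recl.
Qed.

(** In suspended degrees the two exponents merge: a pair of blocks, w' before w, contributes (size w
    - 1) sdegs w'. By [hsign_cat] this is the discrepancy between twisting the whole word and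
    twisting both the blocks and the word of their images. *)
Lemma lsign_koszul (V W : gvect k) (f : gfam V W) (ws : seq (seq (homog V))) :
  hsign (flatten ws) = lsign [seq size w | w <- ws] + koszul ws +
    (\sum_(w <- ws) hsign w + hsign [seq happ (-1) f w | w <- ws]).
Proof.
pose F (ws : seq (seq (homog V))) (l j : nat) :=
  ((size (nth [::] ws l))%:Z - 1) * sdegs (nth [::] ws j).
have -> : lsign [seq size w | w <- ws] + koszul ws =
    \sum_(l < size ws) \sum_(j < l) F ws l j.
  rewrite /lsign /koszul size_map -big_split; apply: eq_bigr => l _ /=.
  rewrite -big_split; apply: eq_bigr => j _ /=.
  have jl := ltn_trans (ltn_ord j) (ltn_ord l).
  by rewrite !(nth_map [::]) // /F /sdegs addrC mulrDr.
elim: ws => [|w ws IHws]; first by rewrite !big_nil big_ord0.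
rewrite [size (w :: ws)]/= ord_sumsS [flatten _]/= hsign_cat IHws big_cons.
rewrite [map _ _]/= hsign_cons size_map tag_happ.
have -> : \sum_(l < size ws) F (w :: ws) l.+1 0%N =
    ((size (flatten ws))%:Z - (size ws)%:Z) * sdegs w.
  rewrite /F /= -mulr_suml; congr (_ * _); elim: ws {IHws} => [|w' ws IHws] /=.
    by rewrite big_ord0.
  by rewrite big_ord_recl /= IHws size_cat -addn1 !PoszD; ring.
rewrite /F /=; ring.
Qed.

Lemma multilinear_signs (U V W : gvect k) (g : gfam V W) (f : gfam U V)
    (pre : seq (homog V)) (ws : seq (seq (homog U))) q : multilinear g ->
  all (fun w => 0 < size w)%N ws ->
  g (pre ++ [seq happ (-1) (hat f) w | w <- ws]) q =
  sgn k (\sum_(w <- ws) hsign w) *: g (pre ++ [seq happ (-1) f w | w <- ws]) q.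
Proof.
move=> gl; elim: ws pre => [|w ws IHws] pre; first by rewrite big_nil scale1r.
case/andP=> w0 wsP; rewrite !map_cons happ_hat; last by case: w w0.
rewrite (linear_scale (multilinear_linear _ _ _ gl)).
rewrite -[Tagged V (f w _)](happ_at (e := -1)) // -!cat_rcons IHws //.
by rewrite scalerA big_cons sgnD.
Qed.

Lemma hat_gcomp (U V W : gvect k) (g : gfam V W) (f : gfam U V) :
  multilinear g -> hat (gcomp g f) = comp (hat f) (hat g).
Proof.
move=> gl; apply: gfamP => v q; have [->//|v0] := eqVneq v [::].
rewrite hatE // /gcomp /comp /=.
pose F sh := (sgn k (lsign sh) * sgn k (koszul (reshape sh v))) *:
  g [seq happ (-1) f w | w <- reshape sh v] q.
rewrite (sum_tuple_compositions F) ?lt0n ?size_eq0 // blocksum_compositions.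
rewrite scaler_sumr [LHS]big_seq [RHS]big_seq; apply: eq_bigr => sh.
rewrite mem_compositions => /andP[sh0 /eqP shv]; rewrite /F.
have wsE : flatten (reshape sh v) = v by rewrite reshapeKr ?shv.
have shE : [seq size w | w <- reshape sh v] = sh by rewrite -/(shape _) reshapeKl ?shv.
have wsP : all (fun w => 0 < size w)%N (reshape sh v).
  by rewrite -(all_map size (fun n => 0 < n)%N) shE.
rewrite hatE; last by rewrite -size_eq0 size_map; case: (reshape _ _) wsE v0 => // <-.
rewrite (multilinear_signs f [::] q gl wsP) !scalerA -!sgnD.
rewrite -{1}wsE (lsign_koszul f) shE.
rewrite (@eq_hsign _ [seq happ (-1) (hat f) w | w <- reshape sh v]
   [seq happ (-1) f w | w <- reshape sh v]); last by rewrite -!map_comp.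
congr (_ *: _); apply: (sgn_mod2 (lsign sh + koszul (reshape sh v))).
ring.
Qed.

End Desuspension.

(** * The identity, and morphisms into a dg-algebra *)

Section Identity.
Variables (k : fieldType) (V : gvect k).

Definition id_component (i j : int) (x : V i) : V j := untag (0 : V j) id (Tagged V x).

Lemma id_componentE i (x : V i) : id_component i x = x.
Proof. by rewrite /id_component (untagE _ _ (u := Tagged V x) (erefl i)). Qed.

Lemma id_component0 i j (x : V i) : j != i -> id_component j x = 0.
Proof. by move=> ji; rewrite /id_component untag_dflt //= eq_sym. Qed.

Fact id_component_linear i j : linear (@id_component i j).
Proof.
move=> a x y; have [->|ji] := eqVneq j i; first by rewrite !id_componentE.
by rewrite !id_component0 // scaler0 addr0.
Qed.

HB.instance Definition _ i j :=
  GRing.isLinear.Build k (V i) (V j) *:%R (@id_component i j) (@id_component_linear i j).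

Fact id_component_deg (i j : int) (x : V i) : j != i + 0 -> id_component j x = 0.
Proof. by rewrite addr0; apply: id_component0. Qed.

Definition glin_id : glin V V 0 :=
  @GLin k V V 0 (fun i j => @id_component i j : {linear V i -> V j}) id_component_deg.

Lemma lin_fam_id : lin_fam glin_id = @gfam_id k V.
Proof. by apply: gfamP => -[|[i x] [|y v]] q. Qed.

Lemma hat_id : hat (@gfam_id k V) = @gfam_id k V.
Proof.
apply: gfamP => -[|x [|y v]] q //; rewrite hatE ?scaler0 //= mul0r addr0.
by rewrite sgn0 scale1r.
Qed.

Lemma hfam_id : hfam (-1) (@gfam_id k V).
Proof. by rewrite -lin_fam_id; apply: hfam_lin. Qed.

Lemma post_id (W : gvect k) (x : gfam W V) : post glin_id x = x.
Proof.
apply: gfamP => v q; rewrite /post; move: (q - 0) (subr0 q) => r ->.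
exact: id_componentE.
Qed.

Lemma comp_id_r (U : gvect k) (f : gfam U V) : hfam (-1) f -> comp f (@gfam_id k V) = f.
Proof. by move=> hf; rewrite -lin_fam_id comp_lin // post_id. Qed.

Lemma ins_id (m : gfam V V) : hfam (-2) m -> ins m (@gfam_id k V) = m.
Proof. by move=> hm; rewrite -lin_fam_id ins_lin // post_id. Qed.

End Identity.

(** Leading term of a composition: a decomposition with fewer blocks than letters feeds [x] a
    shorter word, and single letters pass through [f] unchanged. *)
Lemma comp_unip (k : fieldType) (V W : gvect k) (f : gfam V V) e (x : gfam V W) v q :
  hfam e x -> (forall u q, f [:: u] q = gfam_id [:: u] q) ->
  (forall w q', (size w < size v)%N -> x w q' = 0) -> comp f x v q = x v q.
Proof.
move=> hx f1 x0; rewrite /comp blocksum_top; last first.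
  by move=> ws _ _ wsv; rewrite x0 // size_map.
set v' := map _ _; suff -> : v' = v by [].
rewrite /v' -map_comp -[RHS]map_id; apply/eq_map => -[i u] /=.
rewrite (happ_at (q := i)); last by rewrite sdegs_cons sdegs_nil /=; lia.
by rewrite f1 /= -/(id_component i u) id_componentE.
Qed.

Lemma comp_id_l (k : fieldType) (V W : gvect k) e (x : gfam V W) :
  hfam e x -> comp (@gfam_id k V) x = x.
Proof.
move=> hx; apply: gfamP => v q; rewrite /comp blocksum_top.
  set v' := map _ _; suff -> : v' = v by [].
rewrite /v' -map_comp -[RHS]map_id; apply/eq_map => -[i u] /=.
  rewrite (happ_at (q := i)); last by rewrite sdegs_cons sdegs_nil /=; lia.
  by rewrite /= -/(id_component i u) id_componentE.
move=> ws wsE wsP wsv.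
(* With fewer blocks than letters, some block has length at least two, and the identity family kills
   it. *)
have [pre [w [post [-> w1]]]] :
    exists pre w post, ws = pre ++ w :: post /\ (1 < size w)%N.
  elim: ws {x hx} v wsE wsP wsv => [|w ws IHws] [|y v] //= wsE /andP[w0 wsP].
  case: (ltnP 1 (size w)) => w1; first by exists [::], w, ws.
  case: w w0 w1 wsE => [|z []] // _ _ [_ wsE].
  by case/(IHws _ wsE wsP) => pre [w [post [-> w1]]]; exists ([:: z] :: pre), w, post.
rewrite map_cat map_cons (happ_at (q := sdegs w - 1)) //.
have -> : gfam_id w (sdegs w - 1) = 0 :> V _.
  by case: w w1 {ws wsE wsP wsv pre post} => [|? []].
exact: (hfam_zero _ _ _ _ hx).
Qed.

(** Only one block, giving the differential, or two blocks, giving the product, survive in a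
    dg-algebra. The morphism equation thereby becomes the Maurer-Cartan equation. *)
Lemma comp_dg (k : fieldType) (V A : gvect k) (D : dgAlg A) (f : gfam V A) :
  hfam (-1) f ->
  comp f (hat (dg_op D)) = post (dg_d D) f + cprod D (-1) (-1) f f.
Proof.
move=> hf; apply: gfamP => v q; rewrite gfamE comp_first.
have [->|v0] := eqVneq v [::].
  rewrite /= /cprod /= (happ_nil hf) (linear_zero (dgm_linl D _ _)) scaler0.
  by rewrite /post (hfam_nil hf) linear0 !addr0.
rewrite (_ : (if v is [::] then _ else _) = 0) ?add0r; last by case: (v) v0.
have E a b : a != [::] ->
    comp f (fun w => hat (dg_op D) (happ (-1) f a :: w)) b q =
    if b is [::] then hat (dg_op D) [:: happ (-1) f a] q
    else hat (dg_op D) [:: happ (-1) f a; happ (-1) f b] q.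
  move=> a0; rewrite comp_first; case: b => [|y b]; first by rewrite /= addr0.
  rewrite add0r splitsum_nilr // => -[|z a'] x b' //.
  by apply: blocksum0 => -[|w ws] _ _ //; rewrite /hat /= scaler0.
transitivity (splitsum v (fun a b =>
   (if b is [::] then post (dg_d D) f a q else 0) +
   sgn k (-1 * sdegs a) *: dgm D (happ (-1) f a) (happ (-1) f b) q)).
  apply: eq_splitsum => -[|x a] b abv.
    rewrite (happ_nil hf) (linear_zero (dgm_linl D _ _)) scaler0 addr0.
    by case: b abv v0 => // <-.
  rewrite E //; case: b abv => [|y b] abv.
    rewrite (happ_nil hf) (linear_zero (dgm_linr D _ _)) scaler0 addr0.
    rewrite hatE // hsign_cons mul0r add0r [hsign _]/= sgn0 scale1r [LHS]/=.
    have [qE|qN] := eqVneq (q - -1) (sdegs (x :: a) - 1).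
      by rewrite -[LHS]/(dg_d D _ q (tagged (happ (-1) f (x :: a)))) (happ_at qE).
    rewrite /post [f _ (q - -1)](hfam_deg hf) // linear0 glin_deg //.
    by apply: contraNneq qN => ->; rewrite /sdegs /=; lia.
  rewrite add0r hatE // !hsign_cons tag_happ [hsign _]/=; congr (_ *: _).
  by apply: (sgn_mod2 (sdegs (x :: a))); rewrite /=; ring.
by rewrite splitsumD splitsum_nilr.
Qed.

(** * Inverses of unipotent families *)

Section Inverse.
Variables (k : fieldType) (V : gvect k).

(** By [comp_unip], the value of [comp f g - g] on a word depends only on [g] on shorter words, so g
    = id - (comp f g - g) can be solved by recursion. *)
Lemma unipotent_left_inverse (f : gfam V V) : hfam (-1) f ->
  (forall u q, f [:: u] q = gfam_id [:: u] q) ->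
  exists g : gfam V V, [/\ hfam (-1) g,
    forall u q, g [:: u] q = gfam_id [:: u] q & comp f g = @gfam_id k V].
Proof.
move=> hf f1.
have [||g [hg gE]] := @hfam_rec k V V (-1) (fun g => @gfam_id k V - comp f g + g).
- move=> x hx; apply: hfamD => //; apply: hfamB; first exact: hfam_id.
  exact: hfam_comp.
- move=> x y v q hx hy xy; rewrite !gfamE -!addrA; congr (_ + _).
  have := @comp_unip _ _ _ f (-1) (x - y) v q (hfamB hx hy) f1.
  rewrite linearB !gfamE /= => E.
  have {}E : comp f x v q - comp f y v q = x v q - y v q.
    by apply: E => w q' wv; rewrite !gfamE xy // subrr.
  apply/eqP; rewrite -subr_eq0 opprD opprK addrACA -E [- _ + _]addrC.
  by rewrite -[X in _ + X]opprB subrr.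
have gf : comp f g = @gfam_id k V.
  move/(congr1 (fun x => x - g)): gE; rewrite addrK subrr => /esym/eqP.
  by rewrite subr_eq0 => /eqP.
exists g; split=> // u q; rewrite -gf (comp_unip _ hg f1) //.
by case=> // q' _; apply: (hfam_nil hg).
Qed.

(** The left inverse [g] has a left inverse too, which must be [f]. It is a morphism because
    composition with [f] sends [ins m' g] to [ins m id = m], and composition with [g] undoes
    this. *)
Lemma unipotent_inverse (m m' : gfam V V) (f : gfam V V) :
  hfam (-2) m -> hfam (-2) m' -> hfam (-1) f ->
  (forall u q, f [:: u] q = gfam_id [:: u] q) -> ins m f = comp f m' ->
  exists g : gfam V V, [/\ hfam (-1) g, ins m' g = comp g m,
    comp f g = @gfam_id k V & comp g f = @gfam_id k V].
Proof.
move=> hm hm' hf f1 fm.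
have [g [hg g1 gf]] := unipotent_left_inverse hf f1.
have [f' [hf' _ fg']] := unipotent_left_inverse hg g1.
have fg : comp g f = @gfam_id k V.
  suff -> : f = f' by [].
  by rewrite -[RHS](comp_id_l hf') -gf -(comp_comp _ _ hf') fg' comp_id_r.
exists g; split=> //.
have E : comp f (ins m' g) = m by rewrite (comp_ins hg fm) gf ins_id.
rewrite -[in RHS]E (comp_comp _ _ (hfam_ins hm' hg)) fg.
by rewrite (comp_id_l (hfam_ins hm' hg)).
Qed.

End Inverse.

(** * The retract identities on families *)

Section Gauge.
Variables (k : fieldType) (V A : gvect k) (D : dgAlg A).
Variables (p : glin A (dg_homology D) 0) (i : glin (dg_homology D) A 0).
Variable h : glin A A 1.
Hypothesis hdr : deformation_retract D p i h.
Implicit Types (x y : gfam V A) (z : gfam V (dg_homology D)).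

Local Notation d := (dg_d D).

Lemma post_retract x :
  x - post i (post p x) = post d (post h x) + post h (post d x).
Proof.
apply: gfamP => v q; rewrite !gfamE /post.
rewrite (_ : q - -1 - 1 = q); last by lia.
rewrite (_ : q - 0 - 0 = q - 0); last by lia.
rewrite (_ : q - 1 - -1 = q); last by lia.
rewrite (_ : q - 0 = q); last by lia.
rewrite (_ : q - -1 = q + 1); last by lia.
exact: (dr_ip hdr).
Qed.

Lemma post_dd x : post d (post d x) = 0.
Proof.
apply: gfamP => v q; rewrite !gfamE /post; set r := q - -1 - -1.
rewrite (_ : q = r - 1 - 1) /r; last by lia.
rewrite (_ : r - 1 - 1 - -1 = r - 1); last by lia.
exact: dg_dd.
Qed.

Lemma post_hh x : post h (post h x) = 0.
Proof.
apply: gfamP => v q; rewrite !gfamE /post; set r := q - 1 - 1.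
rewrite (_ : q = r + 1 + 1) /r; last by lia.
rewrite (_ : r + 1 + 1 - 1 = r + 1); last by lia.
exact: (dr_hh hdr).
Qed.

Lemma post_hi z : post h (post i z) = 0.
Proof.
apply: gfamP => v q; rewrite !gfamE /post subr0; set r := q - 1.
rewrite (_ : q = r + 1) /r; last by lia.
exact: (dr_hi hdr).
Qed.

Lemma post_pd x : post p (post d x) = 0.
Proof.
apply: gfamP => v q; rewrite !gfamE /post subr0; set r := q - -1.
rewrite (_ : q = r - 1) /r; last by lia.
exact: (dr_p_chain hdr).
Qed.

(** Apply h to the retract identity and use h i = 0 and h h = 0. As a consequence h kills x - d h x,
    which yields the gauge condition. *)
Lemma post_hdh x : post h (post d (post h x)) = post h x.
Proof.
have := congr1 (post h) (post_retract x); rewrite linearB linearD /=.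
by rewrite post_hi subr0 post_hh addr0 => <-.
Qed.

End Gauge.

(** * The transferred structure *)

Section Transfer.
Variables (k : fieldType) (A : gvect k) (D : dgAlg A).
Local Notation H := (dg_homology D).
Variables (p : glin A H 0) (i : glin H A 0) (h : glin A A 1).
Hypothesis hdr : deformation_retract D p i h.
Local Notation d := (dg_d D).
Local Notation "x ** y" := (cprod D (-1) (-1) x y) (at level 40).

Section TransferredStructure.
Variables (I T : gfam H A).
Hypotheses (hI : hfam (-1) I) (hT : hfam (-2) T).
Hypotheses (IE : I = lin_fam i - post h T) (TE : T = I ** I).

Let M : gfam H H := post p T.

Let hM : hfam (-2) M. Proof. by have := hfam_post p hT. Qed.

Let Phi : gfam H A := post d I + T - ins M I.

Let hPhi : hfam (-2) Phi.
Proof.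
apply: hfamB; last by have := hfam_ins hM hI.
by apply: hfamD => //; have := hfam_post d hI.
Qed.

(** Both derivations are applied to T = I * I. The products of [T] with [I] hidden in the two terms
    with [Phi] cancel by associativity: T * I = I * T. *)
Let dTE : post d T + ins M T =
  cprod D (-1 - 1) (-1) Phi I - cprod D (-1) (-1 - 1) I Phi.
Proof.
have assoc : cprod D (-1 - 1) (-1) T I = cprod D (-1) (-1 - 1) I T.
  by rewrite TE; apply: cprodA.
have -> : post d T = cprod D (-1 - 1) (-1) (post d I) I -
    cprod D (-1) (-1 - 1) I (post d I).
  by rewrite TE post_cprod sgnN1 scaleN1r.
have -> : ins M T = cprod D (-1) (-1 - 1) I (ins M I) -
    cprod D (-1 - 1) (-1) (ins M I) I.
  by rewrite TE ins_cprod sgnN1 scaleN1r.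
rewrite cprodBl cprodDl (linearB (cprod D _ _ I)) (linearD (cprod D _ _ I)) /= assoc.
have zmodE (a b c e t : gfam H A) : a - b + (c - e) = a + t - e - (b + t - c).
  rewrite (addrAC a t) (addrAC b t) opprD [RHS]addrACA subrr addr0 opprB.
  by rewrite addrACA [RHS]addrACA [- _ - _]addrC.
exact: zmodE.
Qed.

(** Since d i = 0 and [ins M (lin_fam i)] is i p T, the terms outside the image of h are T - i p T -
    d h T, which is h d T by the retract identity. *)
Let PhiE : Phi = post h (post d T + ins M T).
Proof.
rewrite /Phi IE (linearB (post d)) (linearB (ins M)) /= (ins_lin _ hM) ins_post.
have -> : post d (lin_fam i) = 0.
  apply: gfamP => -[|x [|y v]] q; rewrite !gfamE /post /= ?linear0 //.
  have [->|qN] := eqVneq q (tag x - 1); last first.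
    rewrite [i _ _ _]glin_deg ?linear0 //; apply: contraNneq qN.
    by move: (tag x) => n; lia.
  rewrite (_ : tag x - 1 - -1 = tag x); last by lia.
  exact: (dr_i_chain hdr).
rewrite (linearD (post h)) /=.
have -> : post h (post d T) = T - post i M - post d (post h T).
  by rewrite (post_retract hdr T) addrC addKr.
rewrite sub0r opprB [- _ + T]addrC -!addrA; congr (_ + _).
by rewrite [LHS]addrA [RHS]addrC.
Qed.

Let Phi0 : Phi = 0.
Proof.
apply: gfam_size_ind => v IHv q; rewrite PhiE dTE /post !gfamE.
by rewrite cprod_vanishl // cprod_vanishr // subrr linear0.
Qed.

Lemma transfer_morphism : ins (post p T) I = post d I + T.
Proof. by apply/eqP; rewrite eq_sym -subr_eq0; apply/eqP/Phi0. Qed.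

Lemma transfer_Ainfty : ins (post p T) (post p T) = 0.
Proof.
rewrite ins_post; have -> : ins (post p T) T = - post d T.
  by apply/eqP; rewrite -addr_eq0 addrC -/M dTE Phi0 cprod0l linear0 subrr.
by rewrite linearN /= (post_pd hdr) oppr0.
Qed.

End TransferredStructure.

(** * Gauge fixing *)

Section GaugeFixing.
Variable m : gfam H H.
Hypotheses (hm : hfam (-2) m) (mm : ins m m = 0) (m1 : forall u q, m [:: u] q = 0).
Variable tau : gfam H A.
Hypotheses (htau : hfam (-1) tau) (tauE : ins m tau = post d tau + tau ** tau).

(* For a fixed point [x] of [Th], the element [1 + gam x] transforms [tau] into
   [tau' x], and [h (tau' x) = 0] because [h d h = h]. *)
Let gam (x : gfam H A) := post h x.
Let tau' (x : gfam H A) := x - post d (gam x).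
Let Th (x : gfam H A) := tau + cprod D 0 (-1) (gam x) tau - ins m (gam x)
  - cprod D (-1) 0 (tau' x) (gam x).

Let hgam x : hfam (-1) x -> hfam 0 (gam x).
Proof. by move=> hx; have := hfam_post h hx. Qed.

Let htau' x : hfam (-1) x -> hfam (-1) (tau' x).
Proof. by move=> hx; apply: hfamB => //; have := hfam_post d (hgam hx). Qed.

Let hTh x : hfam (-1) x -> hfam (-1) (Th x).
Proof.
move=> hx; apply: hfamB; last by have := hfam_cprod D (htau' hx) (hgam hx).
apply: hfamB; last by have := hfam_ins hm (hgam hx).
by apply: hfamD => //; have := hfam_cprod D (hgam hx) htau.
Qed.

(** Minimality of [m]: only blocks of length at least two contribute to [ins m x], which therefore
    evaluates [x] on strictly shorter words. This makes the recursion [Th] local. *)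
Let happ_short b : (size b <= 1)%N -> happ (-2) m b = Tagged H (0 : H (sdegs b + -2)).
Proof.
move=> b1; rewrite (happ_at (q := sdegs b + -2)) //.
by case: b b1 => [|u [|? ?]] // _; rewrite ?(hfam_nil hm) ?m1.
Qed.

Lemma ins_singleton u e (x : gfam H A) q : hfam e x -> ins m x [:: u] q = 0.
Proof.
move=> hx; apply: splitsum30 => a b c abc; rewrite happ_short.
  by rewrite (hfam_zero _ _ _ _ hx) scaler0.
by have := congr1 size abc; rewrite !size_cat /=; lia.
Qed.

Let Th_local x y v q : hfam (-1) x -> hfam (-1) y ->
  (forall w q', (size w < size v)%N -> x w q' = y w q') -> Th x v q = Th y v q.
Proof.
move=> hx hy xy.
have gxy w q' : (size w < size v)%N -> gam x w q' = gam y w q'.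
  by move=> wv; rewrite /gam /post xy.
have txy w q' : (size w < size v)%N -> tau' x w q' = tau' y w q'.
  by move=> wv; rewrite /tau' !gfamE xy // /post gxy.
rewrite /Th !gfamE; congr (_ + _ - _ - _).
- by apply: eq_cprod => // q'; apply: hfam_nil; (apply: hgam || exact: htau).
- apply: eq_splitsum3 => a b c abc; congr (_ *: _).
  have [b1|b1] := ltnP 1 (size b).
    by apply: gxy; rewrite -abc !size_cat /=; lia.
  rewrite happ_short //.
  by rewrite (hfam_zero _ _ _ _ (hgam hx)) (hfam_zero _ _ _ _ (hgam hy)).
- by apply: eq_cprod => // q'; apply: hfam_nil; (apply: hgam || apply: htau').
Qed.

(* the differential of the convolution algebra, in degrees -1 and 0 *)
Let del1 (x : gfam H A) := post d x - ins m x.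
Let del0 (x : gfam H A) := post d x + ins m x.

Let del1D x y : del1 (x + y) = del1 x + del1 y.
Proof. by rewrite /del1 (linearD (post d)) (linearD (ins m)) /= opprD addrACA. Qed.

Let del1B x y : del1 (x - y) = del1 x - del1 y.
Proof.
by rewrite /del1 (linearB (post d)) (linearB (ins m)) /= !opprD addrACA.
Qed.

Let del1_del0 g : hfam 0 g -> del1 (del0 g) = 0.
Proof.
move=> hg; rewrite /del1 /del0 (linearD (post d)) (linearD (ins m)) /= (post_dd D).
rewrite (ins_ins mm hg) add0r addr0.
by rewrite ins_post subrr.
Qed.

Let del1_cprod_r t g :
  del1 (cprod D (-1) 0 t g) = cprod D (-1 - 1) 0 (del1 t) g - t ** del0 g.
Proof.
rewrite /del1 cprodBl /del0 (linearD (cprod D _ _ t)) /= opprD.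
have -> : post d (cprod D (-1) 0 t g) =
    cprod D (-1 - 1) 0 (post d t) g - t ** post d g.
  by have := post_cprod D (-1) 0 t g; rewrite sgnN1 scaleN1r.
have -> : ins m (cprod D (-1) 0 t g) =
    t ** ins m g + cprod D (-1 - 1) 0 (ins m t) g.
  by have := ins_cprod D m (-1) 0 t g; rewrite sgn0 scale1r.
by rewrite opprD !addrA [LHS]addrAC; congr (_ - _); rewrite addrAC.
Qed.

Let del1_cprod_l g t :
  del1 (cprod D 0 (-1) g t) = del0 g ** t + cprod D 0 (-1 - 1) g (del1 t).
Proof.
rewrite /del1 /del0 cprodDl (linearB (cprod D _ _ g)) /=.
have -> : post d (cprod D 0 (-1) g t) =
    post d g ** t + cprod D 0 (-1 - 1) g (post d t).
  by have := post_cprod D 0 (-1) g t; rewrite sgn0 scale1r.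
have -> : ins m (cprod D 0 (-1) g t) =
    cprod D 0 (-1 - 1) g (ins m t) - ins m g ** t.
  by have := ins_cprod D m 0 (-1) g t; rewrite sgnN1 scaleN1r.
by rewrite opprB addrACA.
Qed.

(** The hypothesis reads t (1 + g) = (1 + g) tau - del0 g. It gives K (1 + g) = (1 + g) K' for the
    defects K of [t] and K' of [tau] in the Maurer-Cartan equation. As K' = 0, this leaves K = - K *
    g, and K vanishes by induction on length, without inverting 1 + g. *)
Let MC_of_gauge t g : hfam (-1) t -> hfam 0 g ->
  t + cprod D (-1) 0 t g = tau + cprod D 0 (-1) g tau - del0 g ->
  ins m t = post d t + t ** t.
Proof.
move=> ht hg tE; pose K := del1 t + t ** t.
have cancel (a x y : gfam H A) : a + x + (y - a) = x + y.
  by rewrite addrC addrA subrK addrC.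
(* The gauge equation is differentiated, then multiplied by [t] on the left, then by [tau] on the
   right; in the sum all terms with [del0 g] cancel. *)
have E1 : del1 t + cprod D (-1 - 1) 0 (del1 t) g =
    t ** del0 g + (del0 g ** tau + (del1 tau + cprod D 0 (-1 - 1) g (del1 tau))).
  have := congr1 del1 tE.
  rewrite del1B del1_del0 // !del1D subr0 del1_cprod_r del1_cprod_l.
  move/(congr1 (fun x => x + t ** del0 g)); rewrite -addrA subrK => ->.
  by rewrite addrC; congr (_ + _); rewrite addrCA.
have E2 : t ** t + cprod D (-1 - 1) 0 (t ** t) g =
    t ** tau + t ** cprod D 0 (-1) g tau - t ** del0 g.
  have := congr1 (fun x => t ** x) tE.
  rewrite /= (linearB (cprod D _ _ t)) !(linearD (cprod D _ _ t)) /= => <-.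
  by congr (_ + _); apply: (cprodA D (-1) (-1) 0).
have E3 : t ** tau + t ** cprod D 0 (-1) g tau =
    tau ** tau + cprod D 0 (-1 - 1) g (tau ** tau) - del0 g ** tau.
  have := congr1 (fun x => x ** tau) tE; rewrite /= cprodBl !cprodDl => E.
  transitivity (t ** tau + cprod D (-1) 0 t g ** tau).
    by congr (_ + _); apply/esym/(cprodA D (-1) 0 (-1)).
  by rewrite E; congr (_ + _ - _); apply: (cprodA D 0 (-1) (-1)).
have tau0 : del1 tau = - (tau ** tau) by rewrite /del1 tauE opprD addrA subrr sub0r.
have KE : K = - cprod D (-1 - 1) 0 K g.
  apply/eqP; rewrite -addr_eq0 /K cprodDl addrACA E1 E2 cancel E3 cancel tau0.
  by rewrite linearN /= -opprD addNr.
have hK : hfam (-1 - 1) K.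
  apply: hfamD; last by have := hfam_cprod D ht ht.
  by apply: hfamB; [have := hfam_post d ht | have := hfam_ins hm ht].
have K0 : K = 0.
  apply: gfam_size_ind => v IHv q; rewrite KE !gfamE.
  by rewrite (cprod_vanishl D q hK hg) ?oppr0.
apply/eqP; rewrite eq_sym -subr_eq0 addrAC; apply/eqP; exact: K0.
Qed.

Lemma gauge_fixing : exists t : gfam H A, [/\ hfam (-1) t,
  ins m t = post d t + t ** t, post h t = 0 &
  forall u q, post p t [:: u] q = post p tau [:: u] q].
Proof.
have [x [hx xE]] := hfam_rec hTh Th_local.
exists (tau' x); split=> [| | |u q].
- exact: htau'.
- apply: (MC_of_gauge (htau' hx) (hgam hx)).
  (* Rearranged, the fixed point equation is the gauge equation for g = [gam x]. *)
  rewrite {1}/tau' {1}xE /Th /del0 opprD addrA.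
  by rewrite [LHS]addrAC subrK [LHS]addrAC.
- by rewrite /tau' linearB /= /gam (post_hdh hdr) subrr.
(* On one letter products and insertions vanish, so [tau' x] and [tau] differ there by d h x, which
   p kills. *)
have E1 q' : cprod D 0 (-1) (gam x) tau [:: u] q' = 0.
  apply: (cprod_vanishl D q' (hgam hx) htau) => -[|? ?] // q'' _.
  exact: (hfam_nil (hgam hx)).
have E2 q' : cprod D (-1) 0 (tau' x) (gam x) [:: u] q' = 0.
  apply: (cprod_vanishr D q' (htau' hx) (hgam hx)) => -[|? ?] // q'' _.
  exact: (hfam_nil (hgam hx)).
have E3 q' : ins m (gam x) [:: u] q' = 0 := ins_singleton u q' (hgam hx).
rewrite /tau' linearB /= (post_pd hdr) subr0 {1}xE /post /Th !gfamE.
by rewrite E1 E2 E3 !subr0 addr0.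
Qed.

End GaugeFixing.

(** * Uniqueness from the gauge-fixed element *)

Section Uniqueness.
Variables (I T : gfam H A) (t : gfam H A) (m : gfam H H).
Hypotheses (hI : hfam (-1) I) (hT : hfam (-2) T).
Hypotheses (IE : I = lin_fam i - post h T) (TE : T = I ** I).
Hypotheses (ht : hfam (-1) t) (tE : ins m t = post d t + t ** t) (ht0 : post h t = 0).

Let phi : gfam H H := post p t.

Let hphi : hfam (-1) phi. Proof. by have := hfam_post p ht. Qed.

(* [h t = 0] turns the Maurer-Cartan equation into the recursion defining
   [comp phi I]. *)
Lemma gauge_fixedE : t = comp phi I.
Proof.
have tE' : t = post i phi - post h (t ** t).
  have := post_retract hdr t; rewrite ht0 linear0 add0r => E.
  have := congr1 (post h) tE; rewrite -ins_post ht0 linear0 linearD /= => /esym/eqP.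
  by rewrite addr_eq0 -E => /eqP <-; rewrite addrC subrK.
have IE' : comp phi I = post i phi - post h (comp phi I ** comp phi I).
  by rewrite {1}IE linearB /= (comp_lin hphi) comp_post TE comp_cprod.
have hcI := hfam_comp hphi hI.
apply: gfam_size_ind => v IHv q; rewrite tE' IE' !gfamE; congr (_ - _).
by rewrite /post; congr (h _ _ _); apply: eq_cprod => [||||w q' wv|w q' wv];
  rewrite ?IHv // => q'; apply: hfam_nil; eassumption.
Qed.

(** Project the Maurer-Cartan equation by p: p d = 0, and t * t is the composite of I * I = T with
    the coalgebra map of [phi]. *)
Lemma gauge_fixed_morphism : ins m phi = comp phi (post p T).
Proof.
rewrite ins_post tE linearD /= (post_pd hdr) add0r comp_post TE comp_cprod.
by rewrite -gauge_fixedE.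
Qed.

End Uniqueness.
End Transfer.

(** * Homology classes and the retract *)

Section HomologyClasses.
Variables (k : fieldType) (V : gvect k) (d : glin V V (-1)) (n : int).

Lemma hclass_hrepr (c : homology_at d n) : hclass d (hrepr c) = c.
Proof. by rewrite /hclass /hrepr valKd reprK. Qed.

Lemma eq_hclass (x y : V n) (b : V (n + 1)) : is_cycle d x -> is_cycle d y ->
  d (n + 1) n b = x - y -> hclass d x = hclass d y.
Proof.
move=> xd yd bE; apply/eqP; rewrite /hclass -Quotient.idealrBE.
apply/asboolP; exists b; rewrite bE.
by rewrite -[in RHS]/(val (_ - _)) /= !insubdK.
Qed.

(** Every vector is a cycle and only 0 is a boundary, so the class of [x] has no other
    representative to choose. *)
Lemma hrepr_hclass (x : V n) : (forall i j y, d i j y = 0) -> hrepr (hclass d x) = x.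
Proof.
move=> d0; have xd : is_cycle d x by rewrite /is_cycle d0.
rewrite /hrepr /hclass; set z := insubd _ x.
have : \pi_(homology_at d n) (repr (\pi_(homology_at d n) z)) = \pi_(homology_at d n) z.
  by rewrite reprK.
move/eqP; rewrite -Quotient.idealrBE => /asboolP[b]; rewrite d0 /= => /esym/eqP.
rewrite subr_eq0 => /eqP ->.
exact: (insubdK (0 : zcycle d n) xd).
Qed.

End HomologyClasses.

Section RetractOnHomology.
Variables (k : fieldType) (A : gvect k) (D : dgAlg A).
Local Notation H := (dg_homology D).
Variables (p : glin A H 0) (i : glin H A 0) (h : glin A A 1).
Hypothesis hdr : deformation_retract D p i h.
Local Notation d := (dg_d D).
Local Notation cls := (hclass (m1 (dg_Ainfty D))).

Lemma proj_boundary (q r : int) (x : A r) : p q q (d r q x) = 0.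
Proof.
have [->|qN] := eqVneq q (r - 1); first exact: (dr_p_chain hdr).
by rewrite [d _ _ _]glin_deg ?linear0.
Qed.

(** z - i p z is the boundary of h z, and i p z represents p z. *)
Lemma proj_cycle (n : int) (z : A n) : d n (n - 1) z = 0 -> p n n z = cls z.
Proof.
move=> zd; rewrite -[LHS](dr_repr hdr); apply/esym.
apply: (@eq_hclass _ _ (m1 (dg_Ainfty D)) n z _ (h n (n + 1) z)).
- exact/eqP.
- by apply/eqP; apply: (dr_i_chain hdr).
- by rewrite (dr_ip hdr) zd linear0 addr0.
Qed.

Lemma proj_mul_boundaryl (u w : homog A) q : d (tag w) (tag w + -1) (tagged w) = 0 ->
  p q q (dgm D (hd D u) w q) = 0.
Proof.
move=> wd; have := proj_boundary q (dgm D u w (q - -1)).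
rewrite dgm_leibniz /hd wd linearD /=.
by rewrite (linear_zero (dgm_linr D _ _)) scaler0 linear0 addr0.
Qed.

Lemma proj_mul_boundaryr (u w : homog A) q : d (tag u) (tag u + -1) (tagged u) = 0 ->
  p q q (dgm D u (hd D w) q) = 0.
Proof.
move=> ud; have := proj_boundary q (dgm D u w (q - -1)).
rewrite dgm_leibniz {1}/hd ud (linear_zero (dgm_linl D _ _)) add0r linearZ /=.
by move/(congr1 (fun y => sgn k (tag u) *: y)); rewrite scalerA sgn_sqr scale1r scaler0.
Qed.

Lemma cycle_decomposition (n : int) (a : A n) : d n (n - 1) a = 0 ->
  a = i n n (p n n a) + d (n + 1) n (h n (n + 1) a).
Proof.
move=> ad; have := dr_ip hdr a; rewrite ad linear0 addr0 => <-.
by rewrite addrC subrK.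
Qed.

Lemma boundary_hd (n : int) (y : A (n + 1)) :
  Tagged A (d (n + 1) n y) = hd D (Tagged A y).
Proof. by apply: (@tagged_at _ _ (fun q => d (n + 1) q y)); rewrite addrK. Qed.

(** A cycle differs from its image under i p by a boundary, and the product of a boundary and a
    cycle is a boundary, killed by p. This makes m_2 the induced product. *)
Lemma proj_mul (n n' q : int) (a : A n) (b : A n') :
  d n (n - 1) a = 0 -> d n' (n' - 1) b = 0 ->
  p q q (dgm D (Tagged A (i n n (p n n a))) (Tagged A (i n' n' (p n' n' b))) q) =
  p q q (dgm D (Tagged A a) (Tagged A b) q).
Proof.
move=> ad bd; rewrite [in RHS](cycle_decomposition ad).
rewrite (linear_add (dgm_linl D _ _)) boundary_hd linearD /=.
rewrite proj_mul_boundaryl // addr0 [in RHS](cycle_decomposition bd).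
rewrite (linear_add (dgm_linr D _ _)) boundary_hd linearD /=.
by rewrite proj_mul_boundaryr ?addr0 //; apply: (dr_i_chain hdr).
Qed.

End RetractOnHomology.

(** * The recursion for lambda as a convolution identity *)

Section TransferFamilies.
Variables (k : fieldType) (A : gvect k) (D : dgAlg A).
Local Notation H := (dg_homology D).
Variables (p : glin A H 0) (i : glin H A 0) (h : glin A A 1).

(** The convention h lambda_1 = - id makes nu an instance of the recursion: for k = l = 1 the sign
    is 1 and the two minus signs cancel. On fewer than two letters both sides are 0. *)
Lemma lambda_split (w : seq (homog A)) q :
  lambda D h w q = mul_split D (hcomp h (lambda D h)) w q.
Proof.
have [w3|] := ltnP 2 (size w); first exact: lambdaE.
case: w => [|x [|y [|? ?]]] // _; [by rewrite /lambda /= /mul_split !big_geq .. |].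
pose f := hcomp h (lambda D h); rewrite lambda2 /mul_split big_nat1.
rewrite -[RHS]/((sgn k 2%N * sgn k ((1 - 1) * degs [:: x])) *:
  dgm D (happ (-1) f [:: x]) (happ (-1) f [:: y]) q) subrr mul0r -sgnD.
rewrite (sgn_mod2 1 (z' := 0)) // sgn0 scale1r.
have E (u : homog A) : happ (-1) f [:: u] = Tagged A (- tagged u).
  case: u => j u; rewrite (happ_at (q := j)); last first.
    by rewrite sdegs_cons sdegs_nil /=; lia.
  by rewrite /f /hcomp /= -/(id_component j u) id_componentE.
rewrite !E -scaleN1r (linear_scale (dgm_linl D _ _)) -[- tagged y]scaleN1r.
by rewrite (linear_scale (dgm_linr D _ _)) !scaleN1r opprK.
Qed.

Lemma transfer_incl_hcomp (v : seq (homog H)) q : v != [::] ->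
  hcomp h (lambda D h) (incl_all i v) q = - transfer_incl D i h v q.
Proof.
case: v => [|[n x] [|y v]] // _; last by rewrite opprK.
rewrite /hcomp /= -/(id_component q (i n n x)); congr (- _).
have [->|qN] := eqVneq q n; first exact: id_componentE.
by rewrite id_component0 // glin_deg // addr0.
Qed.

Definition transfer_lambda : gfam H A := fun v q => lambda D h (incl_all i v) q.

Lemma transfer_lambda1 x q : transfer_lambda [:: x] q = 0.
Proof. by rewrite /transfer_lambda lambda_split /mul_split big_geq. Qed.

Lemma degs_incl_all (v : seq (homog H)) : degs (incl_all i v) = degs v.
Proof. by rewrite /degs /incl_all big_map. Qed.

Lemma transfer_lambdaE v q : transfer_lambda v q =
  \sum_(1 <= a < size v)
    (sgn k (a * (size v - a + 1))%N *
     sgn k (((size v - a)%N%:Z - 1) * degs (take a v))) *: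
    dgm D (happ (-1) (transfer_incl D i h) (take a v))
          (happ (-1) (transfer_incl D i h) (drop a v)) q.
Proof.
rewrite /transfer_lambda lambda_split /mul_split size_map big_nat [RHS]big_nat.
apply: eq_bigr => a /andP[a0 av]; rewrite -map_take -map_drop degs_incl_all.
congr (_ *: _).
have E (u : seq (homog H)) : u != [::] ->
    happ (-1) (hcomp h (lambda D h)) (incl_all i u) =
    Tagged A (- transfer_incl D i h u (sdegs u - 1)).
  move=> u0; rewrite -(transfer_incl_hcomp _ u0).
  by apply: happ_at; rewrite /sdegs degs_incl_all size_map.
have [u0 w0] : take a v != [::] /\ drop a v != [::].
  by rewrite -!size_eq0 size_takel 1?ltnW // size_drop -!lt0n subn_gt0.
rewrite -!/(incl_all i _) !E //.
rewrite (happ_at (v := take a v) (q := sdegs (take a v) - 1)) //.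
rewrite (happ_at (v := drop a v) (q := sdegs (drop a v) - 1)) //.
rewrite -/(dgm D (Tagged A (- _)) (Tagged A (- _)) q).
rewrite -scaleN1r (linear_scale (dgm_linl D _ _)).
rewrite -[- transfer_incl D i h (drop _ _) _]scaleN1r.
by rewrite (linear_scale (dgm_linr D _ _)) !scaleN1r opprK.
Qed.

(** The twist turns (-1)^(k(l+1)) and the Koszul sign into the sign of the convolution product; cuts
    with an empty half vanish. *)
Lemma hat_transfer_lambda :
  hat transfer_lambda =
  cprod D (-1) (-1) (hat (transfer_incl D i h)) (hat (transfer_incl D i h)).
Proof.
set I := transfer_incl D i h.
have n0 : happ (-1) (hat I) [::] = Tagged A (0 : A (-1)).
  by rewrite (happ_at (q := -1)) // sdegs_nil.
apply: gfamP => v q; have [->|v0] := eqVneq v [::].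
  by rewrite /cprod /= n0 (linear_zero (dgm_linl D _ _)) scaler0.
rewrite hatE // transfer_lambdaE scaler_sumr /cprod splitsumE.
have vs : (0 < size v)%N by rewrite lt0n size_eq0.
rewrite [RHS]big_nat_recr //= drop_size n0 (linear_zero (dgm_linr D _ _)) scaler0 addr0.
rewrite [RHS]big_ltn // take0 n0 (linear_zero (dgm_linl D _ _)) scaler0 add0r.
rewrite big_nat [RHS]big_nat; apply: eq_bigr => a /andP[a0 av].
have [u0 w0] : take a v != [::] /\ drop a v != [::].
  by rewrite -!size_eq0 size_takel 1?ltnW // size_drop -!lt0n subn_gt0.
rewrite !happ_hat // (linear_scale (dgm_linl D _ _)) (linear_scale (dgm_linr D _ _)).
rewrite [happ (-1) I (take a v)](happ_at (q := sdegs (take a v) - 1)) //.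
rewrite [happ (-1) I (drop a v)](happ_at (q := sdegs (drop a v) - 1)) //.
rewrite !scalerA -!sgnD; congr (_ *: _).
rewrite -{1}(cat_take_drop a v) hsign_cat size_drop.
set l := (size v - a)%N; rewrite /sdegs size_takel 1?ltnW //.
apply: (sgn_mod2 (l%:Z * (degs (take a v) + a%:Z) + a%:Z)).
by rewrite PoszM PoszD; ring.
Qed.

Lemma hat_transfer_incl :
  hat (transfer_incl D i h) = lin_fam i - post h (hat transfer_lambda).
Proof.
apply: gfamP => -[|x [|y v]] q; rewrite !gfamE /post.
- by rewrite /= linear0 subrr.
- rewrite !hatE // transfer_lambda1 scaler0 linear0 subr0 /=.
  by rewrite mul0r addr0 sgn0 scale1r.
- by rewrite !hatE // linearZ sub0r /= scalerN.
Qed.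

Lemma hat_transfer_op : hat (transfer_op D p i h) = post p (hat transfer_lambda).
Proof.
apply: gfamP => -[|x [|y v]] q; rewrite /post.
- by rewrite linear0.
- by rewrite !hatE // transfer_lambda1 /transfer_op /= !scaler0 linear0.
- by rewrite !hatE // linearZ /= subr0.
Qed.

Lemma transfer_incl_nil q : transfer_incl D i h [::] q = 0.
Proof. by rewrite /transfer_incl /= linear0 oppr0. Qed.

(** Multilinearity and degree come from uniqueness: [hfam_rec] yields a solution of the same
    recursion with these properties, and induction on length identifies it with lambda. *)
Lemma hfam_transfer_lambda : hfam (-2) (hat transfer_lambda).
Proof.
pose I x : gfam H A := lin_fam i - post h x.
have hI x : hfam (-2) x -> hfam (-1) (I x).
  by move=> hx; apply: hfamB; [apply: hfam_lin | have := hfam_post h hx].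
have I0 x q : hfam (-2) x -> I x [::] q = 0 by move=> hx; apply: (hfam_nil (hI x hx)).
have [x hx|x y v q hx hy xy|x [hx xE]] :=
    @hfam_rec k H A (-2) (fun x => cprod D (-1) (-1) (I x) (I x)).
- by have := hfam_cprod D (hI x hx) (hI x hx).
- have Ixy w q' : (size w < size v)%N -> I x w q' = I y w q'.
    by move=> wv; rewrite /I !gfamE /post xy.
  by apply: eq_cprod => // q'; apply: I0.
suff -> : hat transfer_lambda = x by [].
apply: gfam_size_ind => v IHv q; rewrite xE hat_transfer_lambda hat_transfer_incl.
have Ixy w q' : (size w < size v)%N -> I (hat transfer_lambda) w q' = I x w q'.
  by move=> wv; rewrite /I !gfamE /post IHv.
apply: eq_cprod => // q'; try exact: I0.
- by rewrite -hat_transfer_incl.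
- by rewrite -hat_transfer_incl.
Qed.

End TransferFamilies.

(** * Back to A-infinity structures, and the theorem *)

Section HatStructures.
Variable k : fieldType.

Lemma hfam_Ainfty (V : gvect k) (m : Ainfty V) : hfam (-2) (hat m).
Proof. exact: (hfam_hat (AinftyP m).1). Qed.

Lemma ins_Ainfty (V : gvect k) (m : Ainfty V) : ins (hat m) (hat m) = 0.
Proof.
have [[ml _] mm] := AinftyP m.
rewrite -hat_insertion // (eq_hat mm).
by apply: gfamP => -[|x v] q //; rewrite hatE // scaler0.
Qed.

Lemma is_Ainfty_hat (V : gvect k) (m : gfam V V) :
  (forall q, m [::] q = 0) -> hfam (-2) (hat m) -> ins (hat m) (hat m) = 0 -> is_Ainfty m.
Proof.
move=> m0 hm mm; have mg : is_gfam (-2) m by rewrite -(hatK m0); apply: is_gfam_hat.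
split=> //; apply: hat_inj; rewrite hat_insertion ?mm; last exact: mg.1.
by apply: gfamP => -[|x v] q //; rewrite hatE // scaler0.
Qed.

Lemma hat_morphism (V W : gvect k) (m : Ainfty V) (m' : Ainfty W) (f : gfam V W) :
  is_morphism m m' f -> hfam (-1) (hat f) /\ ins (hat m) (hat f) = comp (hat f) (hat m').
Proof.
move=> [fg fm]; split; first exact: hfam_hat.
rewrite -hat_insertion ?(eq_hat fm) ?hat_gcomp //; last exact: fg.1.
exact: (AinftyP m').1.1.
Qed.

Lemma is_morphism_hat (V W : gvect k) (m : Ainfty V) (m' : Ainfty W) (f : gfam V W) :
  hfam (-1) f -> ins (hat m) f = comp f (hat m') -> is_morphism m m' (hat f).
Proof.
move=> hf fm; have fg := is_gfam_hat hf; split=> //; apply: hat_inj.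
rewrite hat_insertion ?hat_gcomp ?(hatK (hfam_nil hf)) //; last exact: fg.1.
exact: (AinftyP m').1.1.
Qed.

Lemma is_isomorphism_hat (V : gvect k) (m m' : Ainfty V) (f : gfam V V) :
  hfam (-1) f -> (forall u q, f [:: u] q = gfam_id [:: u] q) ->
  ins (hat m) f = comp f (hat m') -> is_isomorphism m m' (hat f).
Proof.
move=> hf f1 fm; split; first exact: is_morphism_hat.
have [g [hg gm gf fg]] := unipotent_inverse (hfam_Ainfty m) (hfam_Ainfty m') hf f1 fm.
exists (hat g); split; first exact: is_morphism_hat.
- apply: hat_inj; rewrite hat_gcomp ?hat_id; last exact: (is_gfam_hat hg).1.
  by rewrite (hatK (hfam_nil hf)) (hatK (hfam_nil hg)).
- apply: hat_inj; rewrite hat_gcomp ?hat_id; last exact: (is_gfam_hat hf).1.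
  by rewrite (hatK (hfam_nil hf)) (hatK (hfam_nil hg)).
Qed.

End HatStructures.

Theorem theorem7p7 (k : fieldType) (A : gvect k) (D : dgAlg A)
    (p : glin A (dg_homology D) 0) (i : glin (dg_homology D) A 0)
    (h : glin A A 1) (hdr : deformation_retract D p i h) :
  exists hm : is_Ainfty (transfer_op D p i h),
    let m : Ainfty (dg_homology D) := MkAinfty hm in
    is_minimal_model (dg_Ainfty D) m (transfer_incl D i h) /\
    forall (m' : Ainfty (dg_homology D)) (i' : gfam (dg_homology D) A),
      is_minimal_model (dg_Ainfty D) m' i' ->
      exists f : gfam (dg_homology D) (dg_homology D), is_isomorphism m' m f.
Proof.
set H := dg_homology D; set mA := dg_Ainfty D.
pose T := hat (transfer_lambda i h); pose I := hat (transfer_incl D i h).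
have hT : hfam (-2) T := hfam_transfer_lambda i h.
have IE : I = lin_fam i - post h T := hat_transfer_incl i h.
have TE : T = cprod D (-1) (-1) I I := hat_transfer_lambda i h.
have ME : hat (transfer_op D p i h) = post p T := hat_transfer_op p i h.
have hI : hfam (-1) I.
  by rewrite IE; apply: hfamB; [apply: hfam_lin | have := hfam_post h hT].
have hm : is_Ainfty (transfer_op D p i h).
  apply: is_Ainfty_hat; rewrite ?ME //; first by have := hfam_post p hT.
  exact: (transfer_Ainfty hdr hI hT IE TE).
exists hm; set m := MkAinfty hm.
have Imor : is_morphism m mA (transfer_incl D i h).
  rewrite -(hatK (transfer_incl_nil i h)); apply: is_morphism_hat => //.
  rewrite comp_dg // -TE /= ME; exact: (transfer_morphism hdr hI hT IE TE).
(* A minimal structure has zero differential, as [hrepr_hclass] requires. *)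
have m10 (m' : Ainfty H) : (forall (x : homog H) q, Ainfty_op m' [:: x] q = 0) ->
    forall a b y, m1 m' a b y = 0 by move=> m'0 a b y; apply: m'0.
have repr_i n (x : H n) : hclass (m1 mA) (i n n x) = x := dr_repr hdr x.
split.
  split=> //.
  - move=> n n' a b /eqP ad /eqP bd.
    rewrite -(proj_cycle hdr ad) -(proj_cycle hdr bd).
    (* The product of two cycles is a cycle, so its class is its image under p. *)
    rewrite -[RHS](proj_cycle hdr); last first.
      have mul0b q : dg_mul D q (0 : A (n - 1)) b = 0.
        exact: (linear_zero (dgm_linl D (Tagged A b) q)).
      have mula0 q : dg_mul D q a (0 : A (n' - 1)) = 0.
        exact: (linear_zero (dgm_linr D (Tagged A a) q)).
      by rewrite [LHS]dg_leibniz ad bd mul0b mula0 scaler0 addr0.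
    exact: (proj_mul hdr (n + n') ad bd).
  (* Since i x represents x, taking classes is inverse to the induced map. *)
  - split=> // n; exists (fun x : H n => hclass (m1 m) x) => c; rewrite /homology_map.
      by rewrite [X in hclass (m1 m) X]repr_i hclass_hrepr.
    by rewrite hrepr_hclass ?repr_i //; apply: m10.
  - by move=> n x; rewrite /homology_map hrepr_hclass ?repr_i //; apply: m10.
move=> m' i' [m'1 _ [i'mor _] i'H].
have [htau tauE] := hat_morphism i'mor.
have hm' := hfam_Ainfty m'; have mm' := ins_Ainfty m'.
have m'10 u q : hat m' [:: u] q = 0 by rewrite hatE // m'1 scaler0.
have MC : ins (hat m') (hat i') =
    post (dg_d D) (hat i') + cprod D (-1) (-1) (hat i') (hat i').
  by rewrite tauE comp_dg.
have [t [ht tE ht0 t1]] := gauge_fixing hdr hm' mm' m'10 htau MC.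
exists (hat (post p t)); apply: is_isomorphism_hat.
- by have := hfam_post p ht.
(* On one letter p t is p i', and i' sends x to a cycle of class x, so p returns x. *)
- move=> [n x] q; rewrite t1 /post hatE // [hsign _]/= mul0r addr0 sgn0 scale1r.
  have [->|qN] := eqVneq q n; last first.
    rewrite [RHS]id_component0 // i'mor.1.2 ?linear0 // degs_cons degs_nil subr0.
    by apply: contraNneq qN; rewrite /=; lia.
  rewrite [RHS]id_componentE.
  have := i'H n x; rewrite /homology_map hrepr_hclass; last exact: m10.
  rewrite -(proj_cycle hdr) //.
  (* On one letter the product and the insertion vanish, and the Maurer-Cartan equation says that
     the value of i' is a cycle. *)
  have := congr1 (fun f => f [:: Tagged H x] (n - 1)) MC; rewrite gfamE.
  rewrite (cprod_vanishl D _ htau htau); last by case=> // q' _; apply: (hfam_nil htau).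
  rewrite addr0 /post hatE // [hsign _]/= mul0r addr0 sgn0 scale1r.
  rewrite (_ : n - 1 - -1 = n); last by lia.
  by move=> <-; apply: (ins_singleton hm' m'10 _ _ htau).
rewrite /= ME; exact: (gauge_fixed_morphism hdr hI IE TE ht tE ht0).
Qed.
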